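(* There exist a smooth quadratically convex closed surface $S$ in $H^{3}$ and an oriented line (complete geodesic) $\ell$ of $H^3$ not intersecting $S$ which is a periodic point of the outer billiard map associated with $S$ and whose holonomy is not zero.
   Context: $H^3$ is oriented three-dimensional hyperbolic space of curvature $-1$. $\mathcal{G}_{-1}$ is the space of oriented complete geodesics (oriented lines) of $H^3$: classes $[\alpha]$ of unit speed geodesics modulo $\alpha(\cdot)\sim\alpha(\cdot+t_0)$. ''Smooth'' means $C^\infty$; a closed surface is a compact, connected, embedded surface without boundary; quadratically convex means that the shape operator is definite at every point. Outer billiard map. $\mathcal{U}\subset\mathcal{G}_{-1}$ is the set of oriented lines not intersecting $S$. For $\ell=[\alpha]\in\mathcal{U}$ there are exactly two complete totally geodesic surfaces $P_\pm$ containing $\ell$ and tangent to $S$, at points $p_\pm$. Let $q_\pm=q_\pm(\ell)=\alpha(t_\pm)$ be the point of $\ell$ realizing the distance $d_\pm$ from $\ell$ to $p_\pm$; let $\gamma_\pm$ be the unit speed geodesic with $\gamma_\pm(0)=q_\pm$, $\gamma_\pm(d_\pm)=p_\pm$; let $W_\pm$ be the parallel vector field along $\alpha$ with $W_\pm(t_\pm)=\gamma_\pm'(0)$, the signs being chosen so that $\{W_+,W_-,\alpha'\}$ is a positively oriented frame. $B(\ell)\in\mathcal{U}$ is the oriented line whose velocity at $\gamma_+(2d_+)$ is the parallel transport of $\alpha'(t_+)$ along $\gamma_+$ from $\gamma_+(0)$ to $\gamma_+(2d_+)$. Holonomy. Let $(\ell_0,\dots,\ell_{n-1})$ be an $n$-periodic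 orbit of $B$: the $\ell_k$ are distinct, $\ell_{k+1}=B(\ell_k)$ for $0\le k<n-1$ and $B(\ell_{n-1})=\ell_0$. For $0\le k<n$ let $\delta_k$ be the signed distance from $q_-(\ell_k)$ to $q_+(\ell_k)$ along $\ell_k$: if $\ell_k=[\alpha_k]$ with $\alpha_k$ of unit speed and $\alpha_k(0)=q_-(\ell_k)$, then $\alpha_k(\delta_k)=q_+(\ell_k)$. The holonomy of the periodic orbit (or of the periodic point $\ell_0$) is $\sum_{k=0}^{n-1}\delta_k$. *)

(* Defs.v *)
From HB Require Import structures.
From mathcomp Require Import all_boot all_order all_algebra.
From mathcomp Require Import all_classical all_reals all_analysis.

Set Implicit Arguments.
Unset Strict Implicit.
Unset Printing Implicit Defensive.

Import Order.TTheory GRing.Theory Num.Theory.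
Import numFieldNormedType.Exports.

Local Open Scope classical_set_scope.
Local Open Scope ring_scope.

(* Hyperbolic space is the hyperboloid model in Minkowski space R^{1,3}; the
   coordinate of index 0 is the timelike one. *)

Definition mink (R : realType) (x y : 'rV[R]_4) : R :=
  - (x 0 ord0 * y 0 ord0) + \sum_(i < 3) x 0 (lift ord0 i) * y 0 (lift ord0 i).

Definition H3 (R : realType) : set 'rV[R]_4 :=
  [set x | mink x x = -1 /\ 0 < x 0 ord0].
Arguments H3 : clear implicits.

(* cosh (hdist x y) = - mink x y on H3; the right-hand side is arcosh. *)
Definition hdist (R : realType) (x y : 'rV[R]_4) : R :=
  ln (- mink x y + Num.sqrt (mink x y ^+ 2 - 1)).

(* For p in H3, the orthogonal projection onto T_p H3 = {v | mink p v = 0};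
   the sign is + because mink p p = -1. *)
Definition tproj (R : realType) (p w : 'rV[R]_4) : 'rV[R]_4 :=
  w + mink w p *: p.

(* H3 is oriented by declaring a frame (u, v, w) of T_p H3 positive when
   (p, u, v, w) is a positive basis of R^4. *)
Definition pos_frame (R : realType) (p u v w : 'rV[R]_4) : Prop :=
  0 < \det (\matrix_(i < 4) tnth [tuple p; u; v; w] i).

(* The Levi-Civita connection of H3 is the tangential part of the flat one. *)
Definition parallel (R : realType) (c W : R -> 'rV[R]_4) : Prop :=
  forall t : R, [/\ mink (c t) (W t) = 0,
                    derivable W t 1 &
                    tproj (c t) (W^`()%classic t) = 0].

Definition unit_geodesic (R : realType) (c : R -> 'rV[R]_4) : Prop :=
  [/\ forall t : R, H3 R (c t),
      forall t : R, derivable c t 1,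
      forall t : R, mink (c^`()%classic t) (c^`()%classic t) = 1 &
      parallel c c^`()%classic].

(* Oriented lines: classes of unit speed geodesics modulo shift of the
   parameter. *)
Definition line_of (R : realType) (a : R -> 'rV[R]_4) : set (R -> 'rV[R]_4) :=
  [set b | exists t0 : R, forall t : R, b t = a (t + t0)].

Definition oriented_line (R : realType) (L : set (R -> 'rV[R]_4)) : Prop :=
  exists2 a, unit_geodesic a & L = line_of a.

Definition line_points (R : realType) (L : set (R -> 'rV[R]_4)) :
    set 'rV[R]_4 :=
  [set x | exists a, L a /\ range a x].

(* C^k and smooth maps on an open subset of R^4, by iterated directional
   derivatives. *)
Fixpoint Ck (R : realType) (W : normedModType R) (k : nat) (U : set 'rV[R]_4)
    (f : 'rV[R]_4 -> W) {struct k} : Prop :=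
  match k with
  | 0%N => forall x, U x -> {for x, continuous f}
  | k'.+1 => forall v : 'rV[R]_4,
      (forall x, U x -> derivable f x v) /\ Ck k' U (fun x => 'D_v f x)
  end.

Definition smooth_on (R : realType) (W : normedModType R) (U : set 'rV[R]_4)
    (f : 'rV[R]_4 -> W) : Prop :=
  forall k : nat, Ck k U f.

(* Smooth embedded surfaces of H3 without boundary: locally, regular level sets
   in H3 of a smooth function (restriction of one on an open set of R^4). *)
Definition embedded_surface (R : realType) (S : set 'rV[R]_4) : Prop :=
  S `<=` H3 R /\
  forall p, S p -> exists (U : set 'rV[R]_4) (f : 'rV[R]_4 -> R^o),
    [/\ open U, U p, smooth_on U f,
        S `&` U = [set x | [/\ H3 R x, U x & f x = 0]] &
        forall x, S x -> U x -> exists2 v, mink x v = 0 & 'D_v f x != 0].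

Definition closed_surface (R : realType) (S : set 'rV[R]_4) : Prop :=
  [/\ embedded_surface S, S !=set0, compact S & connected S].

(* Velocities at p of curves lying in S. *)
Definition tangent_space (R : realType) (S : set 'rV[R]_4) (p : 'rV[R]_4) :
    set 'rV[R]_4 :=
  [set v | exists c : R -> 'rV[R]_4,
     [/\ c 0 = p, \forall t \near (0 : R), S (c t) & is_derive (0 : R) 1 c v]].

Definition unit_normal_on (R : realType) (S U : set 'rV[R]_4)
    (N : 'rV[R]_4 -> 'rV[R]_4) : Prop :=
  smooth_on U N /\
  forall x, S x -> U x ->
    [/\ mink x (N x) = 0, mink (N x) (N x) = 1 &
        forall v, tangent_space S x v -> mink (N x) v = 0].

(* Minus the covariant derivative of N in the direction v. *)
Definition shape_operator (R : realType) (N : 'rV[R]_4 -> 'rV[R]_4)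
    (p v : 'rV[R]_4) : 'rV[R]_4 :=
  - tproj p ('D_v N p).

Definition definite_on (R : realType) (T : set 'rV[R]_4)
    (A : 'rV[R]_4 -> 'rV[R]_4) : Prop :=
  (forall v, T v -> v != 0 -> 0 < mink (A v) v) \/
  (forall v, T v -> v != 0 -> mink (A v) v < 0).

(* The local unit normal is unique up to sign, and definiteness does not depend
   on that sign. *)
Definition quadratically_convex (R : realType) (S : set 'rV[R]_4) : Prop :=
  forall p, S p -> exists (U : set 'rV[R]_4) (N : 'rV[R]_4 -> 'rV[R]_4),
    [/\ open U, U p, unit_normal_on S U N &
        definite_on (tangent_space S p) (shape_operator N p)].

(* Complete totally geodesic: the geodesics of H3 starting tangentially to P
   stay in P for all time. *)
Definition totally_geodesic_complete (R : realType) (P : set 'rV[R]_4) : Prop :=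
  [/\ embedded_surface P, connected P &
      forall c, unit_geodesic c -> P (c 0) ->
        tangent_space P (c 0) (c^`()%classic 0) -> range c `<=` P].

Definition tangent_at (R : realType) (P S : set 'rV[R]_4) (p : 'rV[R]_4) :
    Prop :=
  [/\ P p, S p & tangent_space P p = tangent_space S p].

(* One of the two tangent planes P through [a], with its contact point p, the
   foot q = a t of p on the line, the distance d = d(q, p), the geodesic g from
   q to p and the parallel field W along a extending g'(0). *)
Record tangent_plane_data (R : realType) (S : set 'rV[R]_4) (a : R -> 'rV[R]_4)
    (P : set 'rV[R]_4) (p : 'rV[R]_4) (t d : R) (g W : R -> 'rV[R]_4) : Prop :=
  TangentPlaneData {
    tpd_plane : totally_geodesic_complete P;
    tpd_contains : range a `<=` P;
    tpd_tangent : tangent_at P S p;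
    tpd_foot : forall s : R, hdist (a t) p <= hdist (a s) p;
    tpd_dist : d = hdist (a t) p;
    tpd_geodesic : unit_geodesic g;
    tpd_start : g 0 = a t;
    tpd_end : g d = p;
    tpd_parallel : parallel a W;
    tpd_init : W t = g^`()%classic 0
  }.

(* [tp, dp, gp] and [tm, dm, gm] are the parameter of q, the distance and the
   geodesic for the signs + and -. If S is a quadratically convex closed surface
   not met by the line of a, exactly two planes are tangent to S and contain the
   line, each touches S at one point, and positivity of the frame tells them
   apart: all six values are then determined by S and a. *)
Definition billiard_data (R : realType) (S : set 'rV[R]_4) (a : R -> 'rV[R]_4)
    (tp dp : R) (gp : R -> 'rV[R]_4) (tm dm : R) (gm : R -> 'rV[R]_4) : Prop :=
  exists (Pp : set 'rV[R]_4) (pp : 'rV[R]_4) (Wp : R -> 'rV[R]_4)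
         (Pm : set 'rV[R]_4) (pm : 'rV[R]_4) (Wm : R -> 'rV[R]_4),
    [/\ tangent_plane_data S a Pp pp tp dp gp Wp,
        tangent_plane_data S a Pm pm tm dm gm Wm &
        forall s : R, pos_frame (a s) (Wp s) (Wm s) (a^`()%classic s)].

Definition billiard_domain (R : realType) (S : set 'rV[R]_4) :
    set (set (R -> 'rV[R]_4)) :=
  [set L | oriented_line L /\ line_points L `&` S = set0].

(* The graph of the outer billiard map B: L' = B(L). *)
Definition outer_billiard (R : realType) (S : set 'rV[R]_4)
    (L L' : set (R -> 'rV[R]_4)) : Prop :=
  [/\ billiard_domain S L, billiard_domain S L' &
      exists (a : R -> 'rV[R]_4)
             (tp dp : R) (gp : R -> 'rV[R]_4) (tm dm : R) (gm : R -> 'rV[R]_4)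
             (Z b : R -> 'rV[R]_4),
        [/\ unit_geodesic a /\ L = line_of a,
            billiard_data S a tp dp gp tm dm gm,
            parallel gp Z /\ Z 0 = a^`()%classic tp,
            unit_geodesic b /\ L' = line_of b &
            b 0 = gp (2 * dp) /\ b^`()%classic 0 = Z (2 * dp)]].

(* [ordS] is the cyclic successor. *)
Definition periodic_orbit (R : realType) (S : set 'rV[R]_4) (n : nat)
    (l : 'I_n -> set (R -> 'rV[R]_4)) : Prop :=
  injective l /\ forall k : 'I_n, outer_billiard S (l k) (l (ordS k)).

(* delta is the signed distance from q_- to q_+ along L. *)
Definition signed_gap (R : realType) (S : set 'rV[R]_4)
    (L : set (R -> 'rV[R]_4)) (delta : R) : Prop :=
  exists (a : R -> 'rV[R]_4) (dp : R) (gp : R -> 'rV[R]_4)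
         (dm : R) (gm : R -> 'rV[R]_4),
    [/\ unit_geodesic a, L = line_of a &
        billiard_data S a delta dp gp 0 dm gm].

Definition is_holonomy (R : realType) (S : set 'rV[R]_4) (n : nat)
    (l : 'I_n -> set (R -> 'rV[R]_4)) (h : R) : Prop :=
  exists delta : 'I_n -> R,
    (forall k, signed_gap S (l k) (delta k)) /\ h = \sum_(k < n) delta k.

(* Main.v *)
Require Import Defs.
From HB Require Import structures.
From mathcomp Require Import all_boot all_order all_algebra.
From mathcomp Require Import all_classical all_reals all_analysis.
From mathcomp Require Import ring lra.
Import Order.TTheory GRing.Theory Num.Theory.
Import numFieldNormedType.Exports.
Local Open Scope classical_set_scope.
Local Open Scope ring_scope.

(* Consider a skew quadrilateral with ultra-ideal vertices V_0, .., V_3 whose four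
   sides l_k = V_(k-1) V_k cross the hyperbolic space, and let p_k be the midpoint,
   in the plane P_k through V_(k-1), V_k, V_(k+1), of the common perpendicular of
   l_k and l_(k+1). If a convex surface touches each P_k at p_k, then the sides form
   a 4-periodic orbit. The feet on l_k of p_(k-1) and p_k are the intersections of
   l_k with the polar planes of V_(k-1) and V_k, and the orientations of the sides
   alternate, so the holonomy is the alternating sum of the lengths of the truncated
   sides. Here the quadrilateral is invariant under the rotations by pi about three
   orthogonal axes, its truncated sides have lengths a, b, a, b with a <> b, and the
   holonomy is 2 (a - b). No quadric touches the four planes at the points p_k, but
   a compact component of a cubic surface
   A x^2 + B y^2 + C z^2 - D x y z = E does. *)

Set Implicit Arguments.
Unset Strict Implicit.
Unset Printing Implicit Defensive.

(** * Minkowski space *)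

(** The pole [V_k] is orthogonal to the common perpendicular of [l_k] and [l_(k+1)], hence a
    constant parallel field along it, and up to one common sign it is the velocity of both oriented
    lines at their feet. Since the contact point is the midpoint, the billiard map carries one line
    to the other. The obstacle is the convex surface. Tangency prescribes the gradient at a contact
    point [(s1, s2, s3)] up to a factor, and its last component has the sign opposite to the one
    that a convex quadric would give: with [D = 0] it forces [C < 0] when [A, B > 0]. The monomial
    [x y z], invariant under the same rotations, absorbs this and leaves room for [C > 0]. Here
    [x, y, z] are rescaled spatial coordinates of the hyperboloid, not those of the Klein model. In
    them the second fundamental form is, up to a nonzero factor, the Euclidean Hessian plus the
    radial derivative times the metric, so a nonnegative Hessian and a positive radial derivative
    suffice. The distances involved are logarithms of rational numbers, which turns the metric
    checks into rational identities. *)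

Definition crd (R : realType) (k : nat) (x : 'rV[R]_4) : R := x 0 (inord k).

Section MinkowskiAlgebra.
Context {R : realType}.
Implicit Types x y z p q e N : 'rV[R]_4.

Lemma crdD k x y : crd k (x + y) = crd k x + crd k y.
Proof. by rewrite /crd mxE. Qed.

Lemma crdZ k (a : R) x : crd k (a *: x) = a * crd k x.
Proof. by rewrite /crd mxE. Qed.

Lemma crdN k x : crd k (- x) = - crd k x.
Proof. by rewrite /crd mxE. Qed.

Lemma row4P x y : crd 0 x = crd 0 y -> crd 1 x = crd 1 y ->
  crd 2 x = crd 2 y -> crd 3 x = crd 3 y -> x = y.
Proof.
move=> h0 h1 h2 h3; apply/rowP => i; rewrite -(inord_val i).
by case: i => -[|[|[|[|//]]]] ?.
Qed.

Lemma minkE x y : mink x y = - (crd 0 x * crd 0 y) +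
  (crd 1 x * crd 1 y + crd 2 x * crd 2 y + crd 3 x * crd 3 y).
Proof.
rewrite /mink /crd !big_ord_recl big_ord0 addr0 !addrA.
have -> : ord0 = inord 0 :> 'I_4 by apply/val_inj; rewrite /= inordK.
have e1 : lift (inord 0) ord0 = inord 1 :> 'I_4.
  by apply/val_inj; rewrite /= /bump !inordK.
have e2 : lift (inord 0) (lift ord0 ord0) = inord 2 :> 'I_4.
  by apply/val_inj; rewrite /= /bump !inordK.
have e3 : lift (inord 0) (lift ord0 (lift ord0 ord0)) = inord 3 :> 'I_4.
  by apply/val_inj; rewrite /= /bump !inordK.
by rewrite e1 e2 e3.
Qed.

Lemma crd0E x : x 0 ord0 = crd 0 x.
Proof. by congr (x 0 _); apply/val_inj; rewrite /= inordK. Qed.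

Lemma minkC x y : mink x y = mink y x.
Proof. rewrite !minkE; ring. Qed.

Lemma minkDl x y z : mink (x + y) z = mink x z + mink y z.
Proof. rewrite !minkE !crdD; ring. Qed.

Lemma minkZl (a : R) x z : mink (a *: x) z = a * mink x z.
Proof. rewrite !minkE !crdZ; ring. Qed.

Lemma minkDr x y z : mink z (x + y) = mink z x + mink z y.
Proof. by rewrite ![mink z _]minkC minkDl. Qed.

Lemma minkZr (a : R) x z : mink z (a *: x) = a * mink z x.
Proof. by rewrite ![mink z _]minkC minkZl. Qed.

Lemma minkNl x z : mink (- x) z = - mink x z.
Proof. by rewrite -scaleN1r minkZl mulN1r. Qed.

Lemma minkNr x z : mink z (- x) = - mink z x.
Proof. by rewrite -scaleN1r minkZr mulN1r. Qed.

Lemma mink0l x : mink 0 x = 0.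
Proof. by rewrite minkE /crd !mxE; ring. Qed.

Lemma mink0r x : mink x 0 = 0.
Proof. by rewrite minkC mink0l. Qed.

Lemma H3P x : H3 R x <-> mink x x = -1 /\ 0 < crd 0 x.
Proof. by rewrite /H3 /= crd0E. Qed.

(** Cauchy-Schwarz for the spatial parts, obtained from Lagrange's identity, bounds their product by
    the product of the time coordinates. *)
Lemma mink_timelike_lt0 x y : mink x x < 0 -> 0 < crd 0 x ->
  mink y y < 0 -> 0 < crd 0 y -> mink x y < 0.
Proof.
rewrite !minkE; set a := crd 0 x; set b := crd 0 y.
set x1 := crd 1 x; set x2 := crd 2 x; set x3 := crd 3 x.
set y1 := crd 1 y; set y2 := crd 2 y; set y3 := crd 3 y => hx a0 hy b0.
have cs : (x1 * y1 + x2 * y2 + x3 * y3) ^+ 2 <=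
    (x1 ^+ 2 + x2 ^+ 2 + x3 ^+ 2) * (y1 ^+ 2 + y2 ^+ 2 + y3 ^+ 2).
  rewrite -subr_ge0.
  have -> : (x1 ^+ 2 + x2 ^+ 2 + x3 ^+ 2) * (y1 ^+ 2 + y2 ^+ 2 + y3 ^+ 2)
    - (x1 * y1 + x2 * y2 + x3 * y3) ^+ 2 =
    (x1 * y2 - x2 * y1) ^+ 2 + (x1 * y3 - x3 * y1) ^+ 2 +
    (x2 * y3 - x3 * y2) ^+ 2 by ring.
  by rewrite !addr_ge0 ?sqr_ge0.
have lt2 : (x1 * y1 + x2 * y2 + x3 * y3) ^+ 2 < (a * b) ^+ 2.
  apply: (le_lt_trans cs).
  have hx' : x1 ^+ 2 + x2 ^+ 2 + x3 ^+ 2 < a ^+ 2 by rewrite !expr2; lra.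
  have hy' : y1 ^+ 2 + y2 ^+ 2 + y3 ^+ 2 < b ^+ 2 by rewrite !expr2; lra.
  rewrite exprMn; apply: ltr_pM => //; by rewrite !addr_ge0 ?sqr_ge0.
have : x1 * y1 + x2 * y2 + x3 * y3 < a * b.
  rewrite ltNge; apply/negP => h; have ab0 : 0 <= a * b by rewrite mulr_ge0 ?ltW.
  by move: lt2; rewrite ltNge lerXn2r ?nnegrE // (le_trans ab0 h).
lra.
Qed.

(* A unit timelike vector lies on the same sheet as [y] when their product is
   negative: otherwise [- x] would contradict [mink_timelike_lt0]. *)
Lemma H3_of_mink_lt0 x y : mink x x = -1 -> H3 R y -> mink x y < 0 -> H3 R x.
Proof.
move=> xx /H3P[yy y0] xy; apply/H3P; split => //.
have [//|x0|x0] := ltgtP 0 (crd 0 x).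
- have : mink (- x) y < 0.
    apply: mink_timelike_lt0; rewrite ?minkNl ?minkNr ?xx ?yy ?crdN ?opprK //; lra.
  rewrite minkNl; lra.
- move: xx; rewrite minkE -x0 => h.
  have := sqr_ge0 (crd 1 x); have := sqr_ge0 (crd 2 x).
  have := sqr_ge0 (crd 3 x); rewrite !expr2; lra.
Qed.

(** With [a] the time coordinate of [p], the hypotheses turn [a^2 * mink v v] into the squared norm
    of the spatial part of [v] plus that of the cross product of the two spatial parts. *)
Lemma mink_spacelike_gt0 p v : mink p p = -1 -> mink p v = 0 -> v != 0 ->
  0 < mink v v.
Proof.
rewrite !minkE; set a := crd 0 p; set b := crd 0 v.
set x1 := crd 1 p; set x2 := crd 2 p; set x3 := crd 3 p.
set y1 := crd 1 v; set y2 := crd 2 v; set y3 := crd 3 v => pp pv v0.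
have cs : a * a * (y1 * y1 + y2 * y2 + y3 * y3 - b * b) =
    (y1 * y1 + y2 * y2 + y3 * y3) + ((x1 * y2 - x2 * y1) ^+ 2 +
    (x1 * y3 - x3 * y1) ^+ 2 + (x2 * y3 - x3 * y2) ^+ 2).
  have -> : a * a * (y1 * y1 + y2 * y2 + y3 * y3 - b * b) =
    (a * a) * (y1 * y1 + y2 * y2 + y3 * y3) - (a * b) * (a * b) by ring.
  have -> : a * a = 1 + (x1 * x1 + x2 * x2 + x3 * x3) by lra.
  have -> : a * b = x1 * y1 + x2 * y2 + x3 * y3 by lra.
  by ring.
have aa : 0 < a * a.
  have := sqr_ge0 x1; have := sqr_ge0 x2; have := sqr_ge0 x3.
  by rewrite !expr2; lra.
rewrite addrC -(pmulr_rgt0 _ aa) cs ltr_wpDr ?addr_ge0 ?sqr_ge0 //.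
have s0 : 0 <= y1 * y1 + y2 * y2 + y3 * y3.
  by rewrite !addr_ge0 // -expr2 sqr_ge0.
rewrite lt_neqAle s0 andbT eq_sym; apply: contraNneq v0 => /eqP h.
move: h; rewrite !paddr_eq0 ?addr_ge0 -?expr2 ?sqr_ge0 // !sqrf_eq0.
move=> /andP[/andP[/eqP h1 /eqP h2] /eqP h3].
have h0 : b = 0.
  apply/eqP; move: pv; rewrite h1 h2 h3 !mulr0 !addr0 => /eqP.
  rewrite oppr_eq0 mulf_eq0 => /orP[/eqP a0|//].
  by move: aa; rewrite a0 mulr0 ltxx.
apply/eqP/row4P; by rewrite ?[crd _ 0]mxE.
Qed.

End MinkowskiAlgebra.

(** * Differentiation rules for scalar and vector functions *)

Section DerivativesOfCurves.
Context {R : realType}.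

(** Lets a derivative be assembled from the rules and its value be normalized afterwards. *)
Lemma is_derive_cast (V W : normedModType R) (f : V -> W) x v df df' :
  is_derive x v f df -> df = df' -> is_derive x v f df'.
Proof. by move=> h <-. Qed.

Lemma is_derive_add (V W : normedModType R) (f g : V -> W) x v df dg :
  is_derive x v f df -> is_derive x v g dg ->
  is_derive x v (fun y => f y + g y) (df + dg).
Proof. by move=> hf hg; exact: is_deriveD. Qed.

Lemma is_derive_opp (V W : normedModType R) (f : V -> W) x v df :
  is_derive x v f df -> is_derive x v (fun y => - f y) (- df).
Proof. by move=> hf; exact: is_deriveN. Qed.

Lemma is_derive_mul (V : normedModType R) (f g : V -> R) x v df dg :
  is_derive x v f df -> is_derive x v g dg ->
  is_derive x v (fun y => f y * g y) (df * g x + f x * dg).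
Proof.
move=> hf hg; refine (is_derive_cast (is_deriveM hf hg) _).
by rewrite /GRing.scale /= addrC mulrC.
Qed.

Lemma is_derive_mulr (V : normedModType R) (f : V -> R) (a : R) x v df :
  is_derive x v f df -> is_derive x v (fun y => f y * a) (df * a).
Proof.
move=> hf; refine (is_derive_cast (is_derive_mul hf (is_derive_cst a x v)) _).
by rewrite mulr0 addr0.
Qed.

Lemma is_derive_exp (V : normedModType R) (f : V -> R) n x v df :
  is_derive x v f df ->
  is_derive x v (fun y => f y ^+ n) (n%:R * f x ^+ n.-1 * df).
Proof. by move=> hf; have := is_deriveX n hf; rewrite exprfctE. Qed.

Lemma is_derive_mx (V : normedModType R) m n (M : V -> 'M[R]_(m, n)) x v
    (dM : 'M[R]_(m, n)) :
  (forall i j, is_derive x v (fun y => M y i j) (dM i j)) <->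
  is_derive x v M dM.
Proof.
split => [h|[dM1 dM2] i j].
  have d : derivable M x v.
    by apply/derivable_mxP => i j; have [] := h i j.
  split => //; rewrite derive_mx //; apply/matrixP => i j; rewrite mxE.
  by have [] := h i j.
split; first by move/derivable_mxP: dM1; exact.
by rewrite -dM2 derive_mx // mxE.
Qed.

Lemma is_derive_crd (V : normedModType R) (c : V -> 'rV[R]_4) x v dc k :
  is_derive x v c dc -> is_derive x v (fun y => crd k (c y)) (crd k dc).
Proof. by move=> /is_derive_mx; exact. Qed.

Lemma is_derive_mink (V : normedModType R) (c d : V -> 'rV[R]_4) x v dc dd :
  is_derive x v c dc -> is_derive x v d dd ->
  is_derive x v (fun y => mink (c y) (d y)) (mink dc (d x) + mink (c x) dd).
Proof.
move=> hc hd.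
have hck k := is_derive_crd k hc; have hdk k := is_derive_crd k hd.
have -> : (fun y => mink (c y) (d y)) =
  - ((fun y => crd 0 (c y)) * (fun y => crd 0 (d y))) +
  ((fun y => crd 1 (c y)) * (fun y => crd 1 (d y)) +
   (fun y => crd 2 (c y)) * (fun y => crd 2 (d y)) +
   (fun y => crd 3 (c y)) * (fun y => crd 3 (d y))).
  by apply/funext => y; rewrite minkE.
have hm k := is_deriveM (hck k) (hdk k).
have h := is_deriveD (is_deriveN (hm 0%N))
  (is_deriveD (is_deriveD (hm 1%N) (hm 2%N)) (hm 3%N)).
refine (is_derive_cast h _).
by rewrite !minkE /GRing.scale /=; ring.
Qed.

End DerivativesOfCurves.

(** * Geodesics *)

Section HyperbolicFunctions.
Context {R : realType}.
Implicit Types t s : R.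

Definition cosh t : R := (expR t + expR (- t)) / 2.
Definition sinh t : R := (expR t - expR (- t)) / 2.

Lemma expRNM t : expR t * expR (- t) = 1 :> R.
Proof. by rewrite -expRD subrr expR0. Qed.

Lemma cosh2_sinh2 t : cosh t * cosh t - sinh t * sinh t = 1.
Proof. by rewrite -[RHS](expRNM t) /cosh /sinh; field. Qed.

Lemma cosh0 : cosh 0 = 1.
Proof. rewrite /cosh oppr0 expR0; lra. Qed.

Lemma sinh0 : sinh 0 = 0.
Proof. by rewrite /sinh oppr0 subrr mul0r. Qed.

Lemma coshDsinh t : cosh t + sinh t = expR t.
Proof. by rewrite /cosh /sinh; field. Qed.

Lemma coshN t : cosh (- t) = cosh t.
Proof. by rewrite /cosh opprK addrC. Qed.

Lemma sinhN t : sinh (- t) = - sinh t.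
Proof. rewrite /sinh opprK; lra. Qed.

Lemma cosh_ge1 t : 1 <= cosh t.
Proof.
rewrite /cosh.
have -> : expR (- t) = expR (- t / 2) * expR (- t / 2).
  by rewrite -expRD; congr expR; field.
have -> : expR t = expR (t / 2) * expR (t / 2).
  by rewrite -expRD; congr expR; field.
have := sqr_ge0 (expR (t / 2) - expR (- t / 2)).
have : expR (t / 2) * expR (- t / 2) = 1.
  by rewrite -expRD -mulrDl subrr mul0r expR0.
set a := expR (t / 2); set b := expR (- t / 2) => ab.
rewrite expr2 => h; lra.
Qed.

Lemma sinh_ge0 t : 0 <= t -> 0 <= sinh t.
Proof. by move=> t0; rewrite /sinh divr_ge0 // subr_ge0 ler_expR; lra. Qed.

Lemma sinh_gt0 t : 0 < t -> 0 < sinh t.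
Proof. by move=> t0; rewrite /sinh divr_gt0 // subr_gt0 ltr_expR; lra. Qed.

Lemma cosh_gt1 t : 0 < t -> 1 < cosh t.
Proof.
by move=> /sinh_gt0 h; have := cosh2_sinh2 t; have := cosh_ge1 t; nra.
Qed.

Lemma cosh_ln t : 0 < t -> cosh (ln t) = (t + t^-1) / 2.
Proof. by move=> t0; rewrite /cosh expRN lnK. Qed.

Lemma sinh_ln t : 0 < t -> sinh (ln t) = (t - t^-1) / 2.
Proof. by move=> t0; rewrite /sinh expRN lnK. Qed.

Lemma is_derive_expRN t : is_derive t 1 (fun s : R => expR (- s)) (- expR (- t)).
Proof.
have h1 : is_derive t 1 (-%R : R -> R) (- 1) by exact: is_deriveNid.
have h2 := is_derive_expR (- t).
have -> : (fun s : R => expR (- s)) = (@expR R) \o -%R by [].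
have -> : - expR (- t) = -1 * expR (- t) by rewrite mulN1r.
by rewrite mulrC; exact: is_derive1_comp.
Qed.

Lemma is_derive_cosh t : is_derive t 1 cosh (sinh t).
Proof.
exact: (is_derive_mulr 2^-1
  (is_derive_add (is_derive_expR t) (is_derive_expRN t))).
Qed.

Lemma is_derive_sinh t : is_derive t 1 sinh (cosh t).
Proof.
have h := is_derive_mulr 2^-1
  (is_derive_add (is_derive_expR t) (is_derive_opp (is_derive_expRN t))).
by refine (is_derive_cast h _); rewrite opprK.
Qed.

Lemma hdist_cosh (x y : 'rV[R]_4) (d : R) :
  0 <= d -> mink x y = - cosh d -> hdist x y = d.
Proof.
move=> d0 h; rewrite /hdist h opprK sqrrN.
have -> : cosh d ^+ 2 - 1 = sinh d ^+ 2.
  by rewrite !expr2; have := cosh2_sinh2 d; lra.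
by rewrite sqrtr_sqr ger0_norm ?sinh_ge0 // coshDsinh expRK.
Qed.

Lemma le_hdist (x y x' y' : 'rV[R]_4) :
  1 <= - mink x y -> - mink x y <= - mink x' y' -> hdist x y <= hdist x' y'.
Proof.
move=> h1 h2; rewrite /hdist ler_ln ?posrE.
- apply: lerD => //; rewrite ler_wsqrtr // lerD2r -[mink x y]opprK.
  rewrite -[mink x' y']opprK ![(- - _) ^+ 2]sqrrN lerXn2r ?nnegrE //; lra.
- by rewrite ltr_wpDr ?sqrtr_ge0 //; lra.
- by rewrite ltr_wpDr ?sqrtr_ge0 //; lra.
Qed.

End HyperbolicFunctions.

Section Geodesics.
Context {R : realType}.
Implicit Types p q e w v : 'rV[R]_4.

Definition geod q e (t : R) : 'rV[R]_4 := cosh t *: q + sinh t *: e.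

Lemma geod0 q e : geod q e 0 = q.
Proof. by rewrite /geod cosh0 sinh0 scale1r scale0r addr0. Qed.

Lemma crd_geod k q e t : crd k (geod q e t) = cosh t * crd k q + sinh t * crd k e.
Proof. by rewrite crdD !crdZ. Qed.

Lemma is_derive_geod q e (t : R) : is_derive t 1 (geod q e) (geod e q t).
Proof.
apply/is_derive_mx => i j.
have hc := is_derive_cosh t; have hs := is_derive_sinh t.
have -> : (fun s => geod q e s i j) = (fun s => cosh s * q i j + sinh s * e i j).
  by apply/funext => s; rewrite /geod !mxE.
refine (is_derive_cast (is_derive_add (is_derive_mulr (q i j) hc)
  (is_derive_mulr (e i j) hs)) _).
by rewrite /geod !mxE addrC.
Qed.

Lemma derive1_geod q e : (geod q e)^`()%classic = geod e q.
Proof.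
by apply/funext => t; rewrite derive1E; have [_] := is_derive_geod q e t.
Qed.

Definition line_frame q e := [/\ H3 R q, mink e e = 1 & mink q e = 0].

Lemma unit_geodesic_geod q e : line_frame q e -> unit_geodesic (geod q e).
Proof.
move=> [Hq ee qe]; have [qq q0] := (H3P q).1 Hq.
have eq0 : mink e q = 0 by rewrite minkC.
have H t : H3 R (geod q e t).
  apply: (@H3_of_mink_lt0 _ _ q) => //.
    rewrite /geod !(minkDl, minkDr, minkZl, minkZr) qq ee qe eq0.
    by have := cosh2_sinh2 t; lra.
  rewrite /geod !(minkDl, minkZl) qq eq0.
  by have := cosh_ge1 t; lra.
have D t : derivable (geod q e) t 1 by have [] := is_derive_geod q e t.
rewrite /unit_geodesic /parallel derive1_geod; split => // t.
  rewrite /geod !(minkDl, minkDr, minkZl, minkZr) qq ee qe eq0.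
  by have := cosh2_sinh2 t; lra.
split.
- rewrite /geod !(minkDl, minkDr, minkZl, minkZr) qq ee qe eq0; ring.
- by have [] := is_derive_geod e q t.
- rewrite derive1_geod /tproj.
  have -> : mink (geod q e t) (geod q e t) = -1 by have [] := H t.
  by rewrite scaleN1r subrr.
Qed.

Lemma parallel_cst (c : R -> 'rV[R]_4) w :
  (forall t, mink (c t) w = 0) -> parallel c (fun=> w).
Proof.
move=> h t; split => //.
have -> : (fun _ : R => w)^`()%classic t = 0 by rewrite derive1_cst.
by rewrite /tproj mink0l scale0r addr0.
Qed.

(** The geodesic stays in the span of [q] and [e], so a vector orthogonal to both is tangent to [H3]
    all along it. The fields [W] and [Z] of the billiard data are all of this kind. *)
Lemma parallel_geod_cst q e w :
  mink q w = 0 -> mink e w = 0 -> parallel (geod q e) (fun=> w).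
Proof.
move=> h1 h2; apply: parallel_cst => t.
by rewrite /geod minkDl !minkZl h1 h2 !mulr0 addr0.
Qed.

(* The defining equation [tproj c c'' = 0] amounts to [c'' = c], so a linear
   form along [c] vanishes identically as soon as its 1-jet does at [0]. *)
Lemma unit_geodesic_mink0 (c : R -> 'rV[R]_4) (N : 'rV[R]_4) :
  unit_geodesic c -> mink N (c 0) = 0 -> mink N (c^`()%classic 0) = 0 ->
  forall t, mink N (c t) = 0.
Proof.
move=> [Hc Dc cc par] N0 N1.
have dc (t : R) : is_derive t 1 c (c^`()%classic t).
  by rewrite derive1E; apply: derivableP.
have dcc (t : R) : is_derive t 1 c^`()%classic (c t).
  have [ct Dct tp] := par t.
  have d2 : is_derive t 1 c^`()%classic (c^`()%classic^`()%classic t).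
    by rewrite [X in is_derive _ _ _ X]derive1E; apply: derivableP.
  suff -> : c t = c^`()%classic^`()%classic t by [].
  (* Differentiating [mink c c' = 0] gives [mink c c'' = -1], so [tproj c c''] is [c'' - c]. *)
  have [_ h] := is_derive_mink (dc t) d2.
  have : 'D_1 (fun y => mink (c y) (c^`()%classic y)) t = 0.
    have -> : (fun y => mink (c y) (c^`()%classic y)) = cst 0.
      by apply/funext => s; have [] := par s.
    exact: derive_cst.
  rewrite h cc addrC => /addr0_eq h'; move: tp; rewrite /tproj minkC.
  rewrite -[mink _ _]opprK h'.
  by rewrite scaleN1r => /eqP; rewrite subr_eq0 => /eqP ->.
have y1 (t : R) : is_derive t 1 (fun s => mink N (c s)) (mink N (c^`()%classic t)).
  have := is_derive_mink (is_derive_cst N t 1) (dc t).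
  by rewrite mink0l add0r.
have y2 (t : R) : is_derive t 1 (fun s => mink N (c^`()%classic s)) (mink N (c t)).
  have := is_derive_mink (is_derive_cst N t 1) (dcc t).
  by rewrite mink0l add0r.
set y := fun s => mink N (c s) in y1; set z := fun s => mink N (c^`()%classic s) in y2.
have y0 : y 0 = 0 by [].
have z0 : z 0 = 0 by [].
(* From [y' = z] and [z' = y], the combinations [z + y] and [z - y] are multiples of [expR t] and
   [expR (- t)]; both vanish at [0]. *)
have A t : (z t + y t) * expR (- t) = 0.
  have -> : 0 = (z 0 + y 0) * expR (- 0) :> R by rewrite y0 z0 addr0 mul0r.
  apply: (is_derive_0_is_cst (f := fun t => (z t + y t) * expR (- t))) => s.
  refine (is_derive_cast
    (is_derive_mul (is_derive_add (y2 s) (y1 s)) (is_derive_expRN s)) _).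
  by rewrite /y /z; ring.
have B t : (z t - y t) * expR t = 0.
  have -> : 0 = (z 0 - y 0) * expR 0 :> R by rewrite y0 z0 subr0 mul0r.
  apply: (is_derive_0_is_cst (f := fun t => (z t - y t) * expR t)) => s.
  refine (is_derive_cast (is_derive_mul (is_derive_add (y2 s)
    (is_derive_opp (y1 s))) (is_derive_expR s)) _).
  by rewrite /y /z; ring.
move=> t; rewrite -/(y t).
have a : z t + y t = 0.
  by apply/eqP; move/eqP: (A t); rewrite mulf_eq0 (gt_eqF (expR_gt0 _)) orbF.
have b : z t - y t = 0.
  by apply/eqP; move/eqP: (B t); rewrite mulf_eq0 (gt_eqF (expR_gt0 _)) orbF.
by move: (y t) (z t) a b => ? ? ? ?; lra.
Qed.

End Geodesics.

(** * Smooth functions *)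

Lemma continuous_mx (R : realType) (T : topologicalType) m n
    (F : T -> 'M[R]_(m, n)) x :
  (forall i j, {for x, continuous (fun y => F y i j)}) -> {for x, continuous F}.
Proof.
move=> hF P [Q hQ QP].
have h (ij : 'I_m * 'I_n) : nbhs x [set y | Q ij.1 ij.2 (F y ij.1 ij.2)].
  by case: ij => i j; exact: (hF i j (Q i j) (hQ i j)).
have nF : Filter (nbhs x) by exact: nbhs_filter.
apply: filterS (filter_forall nF h) => y hy; apply: QP => i j.
exact: (hy (i, j)).
Qed.

Section SmoothFunctions.
Context {R : realType}.
Variable U : set 'rV[R]_4.
Hypothesis oU : open U.

(** A formula for a derivative is known only on [U]. As [U] is open, functions equal on [U] agree
    near each of its points and share their derivatives there; the inductions on [k] below rely on
    this. *)
Lemma Ck_congr (W : normedModType R) k (f g : 'rV[R]_4 -> W) :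
  (forall x, U x -> f x = g x) -> Ck k U f -> Ck k U g.
Proof.
have nfg (f' g' : 'rV[R]_4 -> W) x : (forall x, U x -> f' x = g' x) -> U x ->
    \forall y \near x, f' y = g' y.
  by move=> fg' Ux; near=> y; apply: fg'; near: y; exact: open_nbhs_nbhs.
elim: k f g => [|k IH] f g fg.
  move=> h x Ux; change (g @ x --> g x); rewrite -(fg x Ux).
  exact: cvg_trans (near_eq_cvg (nfg _ _ _ fg Ux)) (h x Ux).
move=> h v; have [d c] := h v.
split; first by move=> x Ux; apply: (near_eq_derivable (nfg _ _ _ fg Ux)); exact: d.
by apply: IH c => x Ux; exact: near_eq_derive (nfg _ _ _ fg Ux).
Unshelve. all: by end_near. Qed.

Lemma CkD (W : normedModType R) k (f g : 'rV[R]_4 -> W) :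
  Ck k U f -> Ck k U g -> Ck k U (fun x => f x + g x).
Proof.
elim: k f g => [|k IH] f g.
  by move=> hf hg x Ux; apply: continuousD; [exact: hf|exact: hg].
move=> hf hg v; have [df cf] := hf v; have [dg cg] := hg v; split.
  by move=> x Ux; apply: derivableD; [exact: df|exact: dg].
apply: Ck_congr (IH _ _ cf cg) => x Ux.
exact: (esym (deriveD (df x Ux) (dg x Ux))).
Qed.

Lemma smooth_derive (W : normedModType R) (f : 'rV[R]_4 -> W) v :
  smooth_on U f -> smooth_on U (fun x => 'D_v f x).
Proof. by move=> h k; have [] := h k.+1 v. Qed.

Lemma smooth_derivable (W : normedModType R) (f : 'rV[R]_4 -> W) x v :
  smooth_on U f -> U x -> derivable f x v.
Proof. by move=> h; have [+ _] := h 1%N v; exact. Qed.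

Lemma smooth_cst (W : normedModType R) (a : W) : smooth_on U (fun=> a).
Proof.
move=> k; elim: k a => [|k IH] a; first by move=> x _; exact: cst_continuous.
move=> v; split; first by move=> x _; exact: derivable_cst.
by apply: Ck_congr (IH 0) => x _; rewrite derive_cst.
Qed.

Lemma smooth_crd k : smooth_on U (crd k : 'rV[R]_4 -> R^o).
Proof.
case=> [|n]; first by move=> x _; exact: coord_continuous.
move=> v.
have h x : is_derive x v (crd k : 'rV[R]_4 -> R^o) (crd k v).
  exact: is_derive_crd (is_derive_id x v).
split; first by move=> x _; have [] := h x.
by apply: Ck_congr (smooth_cst (crd k v : R^o) n) => x _; have [_] := h x.
Qed.

Lemma smoothD (W : normedModType R) (f g : 'rV[R]_4 -> W) :
  smooth_on U f -> smooth_on U g -> smooth_on U (fun x => f x + g x).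
Proof. by move=> hf hg k; apply: CkD. Qed.

(** The induction on [k] keeps both factors smooth to all orders, because each Leibniz term pairs a
    derivative of one factor with the other factor itself. *)
Lemma smoothM (f g : 'rV[R]_4 -> R^o) :
  smooth_on U f -> smooth_on U g -> smooth_on U (fun x => f x * g x : R^o).
Proof.
move=> + + k; elim: k f g => [|k IH] f g hf hg.
  by move=> x Ux; apply: continuousM; [exact: (hf 0%N)|exact: (hg 0%N)].
move=> v.
have h x : U x -> is_derive x v (fun x => f x * g x : R^o)
    ('D_v f x * g x + f x * 'D_v g x).
  move=> Ux; apply: is_derive_mul; apply: derivableP.
    exact: smooth_derivable hf Ux.
  exact: smooth_derivable hg Ux.
split; first by move=> x Ux; have [] := h x Ux.
apply: Ck_congr (CkD (IH _ _ (smooth_derive v hf) hg)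
  (IH _ _ hf (smooth_derive v hg))) => x Ux.
by have [_] := h x Ux.
Qed.

Lemma smoothMl (a : R) (f : 'rV[R]_4 -> R^o) :
  smooth_on U f -> smooth_on U (fun x => a * f x : R^o).
Proof. by move=> hf; apply: smoothM => //; exact: smooth_cst. Qed.

Lemma smoothB (f g : 'rV[R]_4 -> R^o) :
  smooth_on U f -> smooth_on U g -> smooth_on U (fun x => f x - g x : R^o).
Proof.
move=> hf hg; apply: smoothD => //.
have -> : (fun x => - g x : R^o) = (fun x => -1 * g x : R^o).
  by apply/funext => x; rewrite mulN1r.
exact: smoothMl.
Qed.

(** Reduces directional derivatives to functions of one real variable, so that the chain rule
    [is_derive1_comp] applies. *)
Lemma is_derive_line (V W : normedModType R) (f : V -> W) x v df :
  is_derive x v f df <-> is_derive 0 (1 : R) (fun h : R => f (h *: v + x)) df.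
Proof.
have e : (fun h : R => h^-1 *: (((fun h : R => f (h *: v + x)) \o shift 0) (h *: 1)
    - f (0 *: v + x))) = (fun h => h^-1 *: ((f \o shift x) (h *: v) - f x)).
  by apply/funext => h /=; rewrite addr0 scale0r add0r [_%:A]mulr1.
split=> -[h1 h2]; split.
- by rewrite /derivable e.
- by rewrite /derive e.
- by move: h1; rewrite /derivable e.
- by move: h2; rewrite /derive e.
Qed.

Lemma is_derive_comp1 (V : normedModType R) (phi : R -> R) (f : V -> R)
    x v df dphi : is_derive x v f df -> is_derive (f x) 1 phi dphi ->
  is_derive x v (fun y => phi (f y)) (dphi * df).
Proof.
move=> /is_derive_line hf hphi; apply/is_derive_line.
have h : is_derive ((fun h : R => f (h *: v + x)) 0) 1 phi dphi.
  by rewrite scale0r add0r.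
exact: is_derive1_comp.
Qed.

Lemma is_derive_sqrt (V : normedModType R) (g : V -> R) x v dg : 0 < g x ->
  is_derive x v g dg ->
  is_derive x v (fun y => Num.sqrt (g y)) ((2 * Num.sqrt (g x))^-1 * dg).
Proof. by move=> g0 hg; apply: is_derive_comp1 => //; exact: is_derive1_sqrt. Qed.

Lemma is_derive_inv (V : normedModType R) (f : V -> R) x v df : f x != 0 ->
  is_derive x v f df ->
  is_derive x v (fun y => (f y)^-1) (- (f x)^-1 ^+ 2 * df).
Proof.
move=> fx [h1 h2].
have e := deriveV fx h1; have d := derivableV fx h1.
rewrite h2 in e.
by split; [exact: d|rewrite exprVn; exact: e].
Qed.

Lemma is_derive_isqrt (V : normedModType R) (g : V -> R) x v dg : 0 < g x ->
  is_derive x v g dg ->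
  is_derive x v (fun y => (Num.sqrt (g y))^-1)
    (- 2^-1 * (Num.sqrt (g x))^-1 ^+ 3 * dg).
Proof.
move=> g0 hg; have sn0 : Num.sqrt (g x) != 0 by rewrite gt_eqF // sqrtr_gt0.
refine (is_derive_cast
  (is_derive_inv (f := fun y => Num.sqrt (g y)) sn0 (is_derive_sqrt g0 hg)) _).
by move: (Num.sqrt _) sn0 => s sn0; field.
Qed.

(* The functions [h r^m], [h] smooth and [r = g^(-1/2)], are stable under
   differentiation because [r' = - r^3 g' / 2]. *)
Lemma smooth_mul_isqrt (g h : 'rV[R]_4 -> R^o) m :
  smooth_on U g -> (forall x, U x -> 0 < g x) -> smooth_on U h ->
  smooth_on U (fun x => h x * (Num.sqrt (g x))^-1 ^+ m : R^o).
Proof.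
move=> hg g0 + k; elim: k h m => [|k IH] h m hh.
  move=> x Ux; apply: continuousM; first exact: (hh 0%N).
  apply: (@continuous_comp _ _ _ (fun y => (Num.sqrt (g y))^-1) (fun s => s ^+ m));
    last exact: exprn_continuous.
  apply: continuousV; first by rewrite gt_eqF // sqrtr_gt0 g0.
  by apply: continuous_comp; [exact: (hg 0%N)|exact: sqrt_continuous].
move=> v.
pose r x := (Num.sqrt (g x))^-1.
have hd x : U x -> is_derive x v (fun x => h x * r x ^+ m : R^o)
    ('D_v h x * r x ^+ m + (- (m%:R / 2) * h x * 'D_v g x) * r x ^+ m.+2).
  move=> Ux.
  have h1 := derivableP (smooth_derivable (v := v) hh Ux).
  have h2 := is_derive_isqrt (g0 x Ux) (derivableP (smooth_derivable (v := v) hg Ux)).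
  have h3 := is_derive_exp m h2.
  refine (is_derive_cast (is_derive_mul h1 h3) _); congr (_ + _).
  rewrite -/(r x); move: (r x) ('D_v g x) (h x) => a b c.
  by case: m {h3} => [|m] /=; rewrite ?exprS; field.
split; first by move=> x Ux; have [] := hd x Ux.
have hh' : smooth_on U (fun x => - (m%:R / 2) * h x * 'D_v g x : R^o).
  apply: smoothM; last exact: smooth_derive.
  by apply: smoothM => //; exact: smooth_cst.
apply: Ck_congr (CkD (IH _ m (smooth_derive v hh)) (IH _ m.+2 hh')) => x Ux.
by have [_] := hd x Ux.
Qed.

Lemma smooth_mx (F : 'rV[R]_4 -> 'rV[R]_4) :
  (forall i, smooth_on U (fun x => F x 0 i : R^o)) -> smooth_on U F.
Proof.
move=> + k; elim: k F => [|k IH] F hF.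
  by move=> x Ux; apply: continuous_mx => i j; rewrite (ord1 i); exact: (hF j 0%N).
move=> v.
have hd x : U x -> derivable F x v.
  move=> Ux; apply/derivable_mxP => i j; rewrite (ord1 i).
  exact: smooth_derivable (hF j) Ux.
split => //; apply: IH => i n.
apply: Ck_congr (smooth_derive v (hF i) n) => x Ux.
by rewrite (derive_mx (hd x Ux)) mxE.
Qed.

End SmoothFunctions.

(** * Totally geodesic planes *)

Lemma path_connected_set (R : realType) (T : topologicalType) (A : set T) (p : T) :
  (forall x, A x -> exists c : R -> T,
    [/\ c 0 = p, c 1 = x, forall t, 0 <= t <= 1 -> A (c t) &
        forall t, 0 <= t <= 1 -> {for t, continuous c}]) ->
  connected A.
Proof.
move=> h.
pose J := [set c : R -> T | [/\ c 0 = p, forall t, 0 <= t <= 1 -> A (c t) &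
    forall t, 0 <= t <= 1 -> {for t, continuous c}]].
have -> : A = \bigcup_(c in J) (c @` `[0, 1]).
  apply/seteqP; split => [x /h [c [c0 c1 cA cc]]|x [c [c0 cA cc] [t ht <-]]].
    by exists c => //; exists 1 => //=; rewrite in_itv /= lexx ler01.
  by apply: cA; move: ht; rewrite /= in_itv.
apply: bigcup_connected.
  exists p => c [c0 cA cc]; exists 0 => //=.
  by rewrite in_itv /= lexx ler01.
move=> c [c0 cA cc]; apply: connected_continuous_connected.
  exact: segment_connected.
apply: continuous_in_subspaceT => t; rewrite inE /= in_itv /= => ht.
exact: cc.
Qed.

Section Planes.
Context {R : realType}.
Implicit Types p q e w v N x : 'rV[R]_4.

Definition plane N : set 'rV[R]_4 := [set x | H3 R x /\ mink N x = 0].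

Lemma smooth_mink (U : set 'rV[R]_4) N :
  open U -> smooth_on U (mink N : 'rV[R]_4 -> R^o).
Proof.
move=> oU.
have h k (a : R) : smooth_on U (fun x => a * crd k x : R^o).
  by apply: smoothM => //; [exact: smooth_cst|exact: smooth_crd].
have -> : (mink N : 'rV[R]_4 -> R^o) = (fun x => (- crd 0 N) * crd 0 x +
    (crd 1 N * crd 1 x + crd 2 N * crd 2 x + crd 3 N * crd 3 x)).
  by apply/funext => x; rewrite minkE mulNr.
by do !apply: smoothD.
Qed.

Lemma is_derive_minkr N x v : is_derive x v (mink N : 'rV[R]_4 -> R^o) (mink N v).
Proof.
have := is_derive_mink (is_derive_cst N x v) (is_derive_id x v).
by rewrite mink0l add0r.
Qed.

Lemma embedded_plane N : 0 < mink N N -> embedded_surface (plane N).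
Proof.
move=> N0; split=> [x []//|p _].
exists setT, (mink N : 'rV[R]_4 -> R^o); split => //.
- exact: openT.
- exact: smooth_mink openT.
- by apply/seteqP; split=> x; [move=> [[]]|move=> []].
- move=> x [_ Nx] _; exists N; first by rewrite minkC.
  by have [_ ->] := is_derive_minkr N x N; rewrite gt_eqF.
Qed.

(* Moving on the segment from [p] to [x], which consists of timelike vectors,
   and normalizing. *)
Lemma connected_plane N : connected (plane N).
Proof.
have [[p [Hp Np]]|] := pselect (plane N !=set0); last first.
  by move/nonemptyPn => ->; exact: connected0.
apply: (path_connected_set (p := p)) => x [Hx Nx].
have [pp p0] := (H3P p).1 Hp; have [xx x0] := (H3P x).1 Hx.
have px : mink p x < 0 by apply: mink_timelike_lt0; rewrite ?pp ?xx ?ltrN10.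
pose y (t : R) := (1 - t) *: p + t *: x.
pose g (t : R) := (1 - t) ^+ 2 + t ^+ 2 - 2 * (1 - t) * t * mink p x.
have yy t : mink (y t) (y t) = - g t.
  rewrite /y /g !(minkDl, minkDr, minkZl, minkZr) pp xx (minkC x p); ring.
have g0 t : 0 <= t <= 1 -> 0 < g t.
  move=> /andP[t0 t1]; rewrite /g !expr2.
  have : 0 <= (1 - t) * t by apply: mulr_ge0; lra.
  have := sqr_ge0 (t - 2^-1); rewrite expr2; nra.
have Dy (t : R) : is_derive t 1 y (x - p).
  apply/is_derive_mx => i j.
  have -> : (fun s => y s i j) = (fun s => (1 - s) * p i j + s * x i j).
    by apply/funext => s; rewrite /y !mxE.
  refine (is_derive_cast (is_derive_add (is_derive_mulr (p i j)
    (is_derive_add (is_derive_cst (1 : R^o) t (1 : R^o))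
      (is_derive_opp (is_derive_id t (1 : R^o)))))
    (is_derive_mulr (x i j) (is_derive_id t (1 : R^o)))) _).
  by rewrite !mxE; ring.
have Dg t : derivable (fun s => - mink (y s) (y s)) t 1.
  by have [] := is_derive_opp (is_derive_mink (Dy t) (Dy t)).
exists (fun t => (Num.sqrt (- mink (y t) (y t)))^-1 *: y t); split.
- by rewrite yy /y /g !(subr0, scale0r, addr0, scale1r, mulr0, mul0r) expr1n
    expr0n /= addr0 opprK sqrtr1 invr1 scale1r.
- by rewrite yy /y /g !(subrr, scale0r, add0r, scale1r, mulr0, mul0r) expr1n
    expr0n /= add0r subr0 opprK sqrtr1 invr1 scale1r.
- move=> t ht; have gt := g0 t ht; rewrite yy opprK.
  have s0 : 0 < (Num.sqrt (g t))^-1 by rewrite invr_gt0 sqrtr_gt0.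
  have ss : (Num.sqrt (g t))^-1 * ((Num.sqrt (g t))^-1 * g t) = 1.
    rewrite -{3}(sqr_sqrtr (ltW gt)); field.
    by rewrite gt_eqF // sqrtr_gt0.
  split; last by rewrite minkZr /y minkDr !minkZr Np Nx !mulr0 addr0 mulr0.
  apply: (H3_of_mink_lt0 (y := p)) => //.
    by rewrite minkZl minkZr yy !mulrN ss.
  rewrite minkZl pmulr_rlt0 // /y minkDl !minkZl pp (minkC x).
  move: ht => /andP[t0 t1]; nra.
- move=> t ht; apply: continuousZ.
    apply: continuousV; first by rewrite gt_eqF // sqrtr_gt0 yy opprK g0.
    apply: (@continuous_comp _ _ _ (fun t => - mink (y t) (y t)) (@Num.sqrt R)).
      by apply: differentiable_continuous; apply/derivable1_diffP; exact: Dg.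
    exact: sqrt_continuous.
  apply: differentiable_continuous; apply/derivable1_diffP.
  by have [] := Dy t.
Qed.

Lemma tangent_H3 (S : set 'rV[R]_4) p v :
  S `<=` H3 R -> tangent_space S p v -> mink p v = 0.
Proof.
move=> SH [c [c0 cS dc]].
have [_ h] := is_derive_mink dc dc.
have : 'D_1 (fun s : R => mink (c s) (c s)) 0 = 0.
  rewrite (@near_eq_derive R R^o R^o _ (cst (-1))) ?derive_cst //.
  by apply: filterS cS => t /SH [].
rewrite h c0 (minkC v) => h'; lra.
Qed.

Lemma tangent_planeE N p : plane N p ->
  tangent_space (plane N) p = [set v | mink p v = 0 /\ mink N v = 0].
Proof.
move=> [Hp Np]; have [pp p0] := (H3P p).1 Hp.
apply/seteqP; split => v.
  move=> tv; split; first by apply: tangent_H3 tv => x [].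
  case: tv => c [c0 cS dc].
  have [_ h] := is_derive_mink (is_derive_cst N (0 : R^o) (1 : R^o)) dc.
  have : 'D_1 (fun s : R => mink N (c s)) 0 = 0.
    rewrite (@near_eq_derive R R^o R^o _ (cst 0)) ?derive_cst //.
    by apply: filterS cS => t [].
  by rewrite h mink0l add0r.
move=> [pv Nv].
(* The curve is [p + t v] normalized into [H3]. As [mink p v = 0], the function [g] is stationary at
   [0], so the normalization leaves the velocity [v] unchanged. *)
pose y (t : R) := p + t *: v.
pose g (t : R) := 1 - t * t * mink v v.
have yy t : mink (y t) (y t) = - g t.
  rewrite /y /g !(minkDl, minkDr, minkZl, minkZr) pp (minkC v p) pv; ring.
have Dy (t : R) : is_derive t 1 y v.
  apply/is_derive_mx => i j.
  have -> : (fun s => y s i j) = (fun s => p i j + s * v i j).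
    by apply/funext => s; rewrite /y !mxE.
  refine (is_derive_cast (is_derive_add (is_derive_cst (p i j : R^o) t (1 : R^o))
    (is_derive_mulr (v i j) (is_derive_id t (1 : R^o)))) _).
  by rewrite add0r mul1r.
have Dg : is_derive (0 : R) 1 g 0.
  refine (is_derive_cast (is_derive_add (is_derive_cst (1 : R^o) (0 : R^o) (1 : R^o))
    (is_derive_opp (is_derive_mulr (mink v v)
      (is_derive_mul (is_derive_id (0 : R^o) (1 : R^o)) (is_derive_id (0 : R^o) (1 : R^o)))))) _).
  by ring.
have g00 : g 0 = 1 by rewrite /g !mul0r subr0.
exists (fun t => (Num.sqrt (g t))^-1 *: y t); split.
- by rewrite g00 sqrtr1 invr1 scale1r /y scale0r addr0.
- have cg : {for 0, continuous g}.
    by apply: differentiable_continuous; apply/derivable1_diffP; case: Dg.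
  have : \forall t \near (0 : R), 0 < g t.
    by have /cvgr_gt := cg; apply; rewrite g00 ltr01.
  apply: filterS => t gt.
  have s0 : 0 < (Num.sqrt (g t))^-1 by rewrite invr_gt0 sqrtr_gt0.
  have ss : (Num.sqrt (g t))^-1 * ((Num.sqrt (g t))^-1 * g t) = 1.
    rewrite -{3}(sqr_sqrtr (ltW gt)); field.
    by rewrite gt_eqF // sqrtr_gt0.
  split; last by rewrite minkZr /y minkDr !minkZr Np Nv !mulr0 addr0 mulr0.
  apply: (H3_of_mink_lt0 (y := p)) => //.
    by rewrite minkZl minkZr yy !mulrN ss.
  by rewrite minkZl pmulr_rlt0 // /y minkDl !minkZl pp (minkC v) pv mulr0 addr0
    ltrN10.
- apply/is_derive_mx => i j.
  have -> : (fun t => ((Num.sqrt (g t))^-1 *: y t) i j) =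
      (fun t => (Num.sqrt (g t))^-1 * y t i j).
    by apply/funext => t; rewrite mxE.
  have g0 : 0 < g 0 by rewrite g00 ltr01.
  have hy : is_derive (0 : R) 1 (fun s => y s i j) (v i j).
    by move: i j; apply/is_derive_mx.
  refine (is_derive_cast (is_derive_mul (is_derive_isqrt g0 Dg) hy) _).
  by rewrite mulr0 mul0r add0r g00 sqrtr1 invr1 mul1r.
Qed.

Lemma totally_geodesic_plane N :
  0 < mink N N -> totally_geodesic_complete (plane N).
Proof.
move=> N0; split.
- exact: embedded_plane.
- exact: connected_plane.
- move=> c gc Pc; rewrite (tangent_planeE Pc) => -[_ Nc] _ [t _ <-].
  have [Hc _ _ _] := gc; split; first exact: Hc.
  by apply: unit_geodesic_mink0 => //; case: Pc.
Qed.

Lemma coshB (s t : R) : cosh (s - t) = cosh s * cosh t - sinh s * sinh t.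
Proof.
by rewrite /cosh /sinh opprB addrC ![expR (_ - _)]expRD; field.
Qed.

(** Since [w] is orthogonal to the line, the hyperbolic theorem of Pythagoras gives
    [cosh d * cosh (s - t)] for the [cosh] of the distance from [p] to the point of parameter [s];
    it is least at [s = t]. *)
Lemma tangent_plane_data_geod (S : set 'rV[R]_4) q0 e N p w t d :
  line_frame q0 e -> line_frame (geod q0 e t) w -> 0 <= d ->
  p = geod (geod q0 e t) w d ->
  0 < mink N N -> mink N q0 = 0 -> mink N e = 0 -> mink N w = 0 ->
  mink q0 w = 0 -> mink e w = 0 ->
  S p -> tangent_space S p = [set v | mink p v = 0 /\ mink N v = 0] ->
  tangent_plane_data S (geod q0 e) (plane N) p t d
    (geod (geod q0 e t) w) (fun=> w).
Proof.
move=> lf lfq d0 pE N0 Nq Ne Nw qw ew Sp tS.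
have Nl s : mink N (geod q0 e s) = 0.
  by rewrite /geod minkDr !minkZr Nq Ne !mulr0 addr0.
have [HG _ _ _] := unit_geodesic_geod lf.
have [HG' _ _ _] := unit_geodesic_geod lfq.
have Pp : plane N p.
  by rewrite pE; split => //; rewrite {1}/geod minkDr !minkZr Nl Nw !mulr0 addr0.
have [[[qq _] ee qe]] := (lf, tt).
have eq0 : mink e q0 = 0 by rewrite minkC.
have mp s : mink (geod q0 e s) p = - (cosh d * cosh (s - t)).
  rewrite pE coshB /geod !(minkDl, minkDr, minkZl, minkZr) qq ee qe eq0 qw ew.
  ring.
have mt : mink (geod q0 e t) p = - cosh d by rewrite mp subrr cosh0 mulr1.
constructor => //.
- exact: totally_geodesic_plane.
- by move=> _ [s _ <-]; split.
- by split => //; rewrite tS; exact: tangent_planeE.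
- move=> s; apply: le_hdist; rewrite !mp subrr cosh0 !opprK !mulr1.
    exact: cosh_ge1.
  by rewrite ler_peMr ?cosh_ge1 // (le_trans ler01) // cosh_ge1.
- by rewrite (hdist_cosh d0 mt).
- exact: unit_geodesic_geod.
- exact: geod0.
- exact: parallel_geod_cst.
- by rewrite derive1_geod geod0.
Qed.

End Planes.

(** * Orientation of frames *)

Section Frames.
Context {R : realType}.
Implicit Types p u v w q e : 'rV[R]_4.

Definition det3 (a1 a2 a3 b1 b2 b3 c1 c2 c3 : R) : R :=
  a1 * (b2 * c3 - b3 * c2) - a2 * (b1 * c3 - b3 * c1) + a3 * (b1 * c2 - b2 * c1).

Lemma det3E (M : 'M[R]_3) (f := fun a b : nat => M (inord a) (inord b)) :
  \det M = det3 (f 0 0)%N (f 0 1)%N (f 0 2)%N (f 1 0)%N (f 1 1)%N (f 1 2)%N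
    (f 2 0)%N (f 2 1)%N (f 2 2)%N.
Proof.
have mE i j : M i j = f i j by rewrite /f !inord_val.
rewrite (expand_det_row _ ord0) !big_ord_recl big_ord0 /cofactor.
rewrite !(expand_det_row _ ord0) !big_ord_recl !big_ord0 /cofactor.
rewrite !det_mx11 !mxE !mE /= /bump /= /det3.
by rewrite !(expr0, expr1, addn0, add0n, addn1, add1n, exprS); ring.
Qed.

Definition det4 p u v w : R :=
  crd 0 p * det3 (crd 1 u) (crd 2 u) (crd 3 u) (crd 1 v) (crd 2 v) (crd 3 v)
    (crd 1 w) (crd 2 w) (crd 3 w)
  - crd 1 p * det3 (crd 0 u) (crd 2 u) (crd 3 u) (crd 0 v) (crd 2 v) (crd 3 v)
    (crd 0 w) (crd 2 w) (crd 3 w)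
  + crd 2 p * det3 (crd 0 u) (crd 1 u) (crd 3 u) (crd 0 v) (crd 1 v) (crd 3 v)
    (crd 0 w) (crd 1 w) (crd 3 w)
  - crd 3 p * det3 (crd 0 u) (crd 1 u) (crd 2 u) (crd 0 v) (crd 1 v) (crd 2 v)
    (crd 0 w) (crd 1 w) (crd 2 w).

Lemma pos_frameE p u v w : pos_frame p u v w = (0 < det4 p u v w).
Proof.
rewrite /pos_frame; congr (is_true (0 < _)).
set M := \matrix_(i < 4) _.
have mE i j : M i j = crd j (nth 0 [:: p; u; v; w] i).
  by rewrite /M mxE (tnth_nth 0) /crd inord_val.
clearbody M.
rewrite (expand_det_row _ ord0) !big_ord_recl big_ord0 /cofactor !det3E.
rewrite !mxE !mE /= /bump /= !inordK //= /det4.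
set d1 := det3 _ _ _ _ _ _ _ _ _; set d2 := det3 _ _ _ _ _ _ _ _ _.
set d3 := det3 _ _ _ _ _ _ _ _ _; set d4 := det3 _ _ _ _ _ _ _ _ _.
by rewrite !(expr0, expr1, addn0, add0n, addn1, add1n, exprS); ring.
Qed.

(** The point and velocity at time [t] arise from [q] and [e] by a hyperbolic rotation, of
    determinant [1], so the determinant is constant along the line. *)
Lemma pos_frame_geod q u v e t :
  0 < det4 q u v e -> pos_frame (geod q e t) u v (geod e q t).
Proof.
rewrite pos_frameE.
suff -> : det4 (geod q e t) u v (geod e q t) =
    (cosh t * cosh t - sinh t * sinh t) * det4 q u v e.
  by rewrite cosh2_sinh2 mul1r.
by rewrite /det4 /det3 !crd_geod; ring.
Qed.

End Frames.

(** * The cubic *)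

Section Coordinates.
Context {R : realType}.
Implicit Types (X Y v : 'rV[R]_4) (k : nat).

(* Squares of the units of the coordinates [co], chosen such that the contact
   points are [(1, s1, s2, s3)] with signs [s1], [s2], [s3] of product [1]. *)
Definition scale2 : seq R := [:: 64 / 55; 13 / 385; 247 / (99 * 20); 71 / (99 * 140)].

Definition sc k : R := Num.sqrt (nth 0 scale2 k).

Definition co k X : R := crd k X / sc k.

Definition vec (t x y z : R) : 'rV[R]_4 :=
  \row_(j < 4) (sc j * nth 0 [:: t; x; y; z] j).

Lemma scale2_gt0 k : (k < 4)%N -> 0 < nth 0 scale2 k.
Proof. by case: k => [|[|[|[|//]]]] _ /=; lra. Qed.

Lemma sc_gt0 k : (k < 4)%N -> 0 < sc k.
Proof. by move=> k4; rewrite sqrtr_gt0 scale2_gt0. Qed.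

Lemma crd_co k X : (k < 4)%N -> crd k X = sc k * co k X.
Proof. by move=> /sc_gt0 h; rewrite /co mulrC divfK ?gt_eqF. Qed.

Lemma crdM k X Y : (k < 4)%N ->
  crd k X * crd k Y = nth 0 scale2 k * (co k X * co k Y).
Proof.
move=> k4; rewrite !crd_co // mulrACA -expr2 sqr_sqrtr //.
exact: ltW (scale2_gt0 k4).
Qed.

Lemma mink_co X Y : mink X Y = - (64 / 55 * (co 0 X * co 0 Y)) +
  (13 / 385 * (co 1 X * co 1 Y) + 247 / (99 * 20) * (co 2 X * co 2 Y) +
   71 / (99 * 140) * (co 3 X * co 3 Y)).
Proof. by rewrite minkE !crdM. Qed.

Lemma coD k X Y : co k (X + Y) = co k X + co k Y.
Proof. by rewrite /co crdD mulrDl. Qed.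

Lemma coZ k (a : R) X : co k (a *: X) = a * co k X.
Proof. by rewrite /co crdZ mulrA. Qed.

Lemma crd_vec k t x y z : (k < 4)%N ->
  crd k (vec t x y z) = sc k * nth 0 [:: t; x; y; z] k.
Proof. by move=> k4; rewrite /crd mxE inordK. Qed.

Lemma co_vec k t x y z : (k < 4)%N ->
  co k (vec t x y z) = nth 0 [:: t; x; y; z] k.
Proof.
by move=> k4; rewrite /co crd_vec // mulrAC divff ?mul1r // gt_eqF // sc_gt0.
Qed.

Lemma co0v t x y z : co 0 (vec t x y z) = t. Proof. exact: co_vec. Qed.
Lemma co1v t x y z : co 1 (vec t x y z) = x. Proof. exact: co_vec. Qed.
Lemma co2v t x y z : co 2 (vec t x y z) = y. Proof. exact: co_vec. Qed.
Lemma co3v t x y z : co 3 (vec t x y z) = z. Proof. exact: co_vec. Qed.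
Definition covE := (co0v, co1v, co2v, co3v).

Lemma coP X Y : co 0 X = co 0 Y -> co 1 X = co 1 Y -> co 2 X = co 2 Y ->
  co 3 X = co 3 Y -> X = Y.
Proof. by move=> h0 h1 h2 h3; apply: row4P; rewrite !crd_co // ?h0 ?h1 ?h2 ?h3. Qed.

Lemma crd0_gt0 X : (0 < crd 0 X) = (0 < co 0 X).
Proof. by rewrite /co pmulr_lgt0 // invr_gt0 sc_gt0. Qed.

Lemma smooth_co (U : set 'rV[R]_4) k : open U ->
  smooth_on U (co k : 'rV[R]_4 -> R^o).
Proof.
by move=> oU; apply: smoothM => //; [exact: smooth_crd|exact: smooth_cst].
Qed.

Lemma is_derive_co (V : normedModType R) (c : V -> 'rV[R]_4) (x v : V) dc k :
  is_derive x v c dc -> is_derive x v (fun y => co k (c y)) (co k dc).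
Proof. by move=> h; exact: (is_derive_mulr (sc k)^-1 (is_derive_crd k h)). Qed.

Lemma is_derive_vec (V : normedModType R) (f0 f1 f2 f3 : V -> R)
    (x v : V) d0 d1 d2 d3 :
  is_derive x v f0 d0 -> is_derive x v f1 d1 -> is_derive x v f2 d2 ->
  is_derive x v f3 d3 ->
  is_derive x v (fun y => vec (f0 y) (f1 y) (f2 y) (f3 y)) (vec d0 d1 d2 d3).
Proof.
move=> h0 h1 h2 h3; apply/is_derive_mx => i j.
have -> : (fun y => vec (f0 y) (f1 y) (f2 y) (f3 y) i j) =
    (fun y => nth 0 [:: f0 y; f1 y; f2 y; f3 y] j * sc j).
  by apply/funext => y; rewrite mxE mulrC.
rewrite mxE mulrC; apply: is_derive_mulr.
by case: j => -[|[|[|[|//]]]].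
Qed.

Lemma continuous_vec (T : topologicalType) (f0 f1 f2 f3 : T -> R^o) x :
  {for x, continuous f0} -> {for x, continuous f1} ->
  {for x, continuous f2} -> {for x, continuous f3} ->
  {for x, continuous (fun y => vec (f0 y) (f1 y) (f2 y) (f3 y))}.
Proof.
move=> h0 h1 h2 h3; apply: continuous_mx => i j.
have -> : (fun y => vec (f0 y) (f1 y) (f2 y) (f3 y) i j) =
    (fun y => sc j * nth 0 [:: f0 y; f1 y; f2 y; f3 y] j).
  by apply/funext => y; rewrite mxE.
apply: (@continuousM _ _ (fun=> sc j)); first exact: cst_continuous.
by case: j => -[|[|[|[|//]]]].
Qed.

End Coordinates.

(** * Convexity and bounds for the cubic polynomial *)

Section CubicPolynomial.
Context {R : realType}.
Implicit Types x y z a b c : R.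

(* Tangency to [wall] at [contact] leaves a pencil of cubics of this form; this
   member has a nonnegative Hessian on [box]. *)
Definition cubic x y z : R :=
  366 / 5 * (x * x) + 7307 / 100 * (y * y) + 133 / 100 * (z * z)
  - 6 * (x * y * z) - 708 / 5.

Definition cubic_x x y z : R := 732 / 5 * x - 6 * (y * z).
Definition cubic_y x y z : R := 7307 / 50 * y - 6 * (x * z).
Definition cubic_z x y z : R := 133 / 50 * z - 6 * (x * y).

Definition dcubic x y z a b c : R :=
  cubic_x x y z * a + cubic_y x y z * b + cubic_z x y z * c.

(* Half of the Hessian of [cubic]. *)
Definition hess x y z a b c : R :=
  366 / 5 * (a * a) + 7307 / 100 * (b * b) + 133 / 100 * (c * c)
  - 6 * (z * (a * b) + y * (a * c) + x * (b * c)).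

(** Isolates the compact component: small enough for the Hessian to stay nonnegative, large enough
    for the component to stay away from its boundary. *)
Definition box x y z : Prop :=
  [/\ x * x <= 9 / 4, y * y <= 9 / 4 & z * z <= 121].

Lemma mul_self_ge0 (x : R) : 0 <= x * x.
Proof. by rewrite -expr2 sqr_ge0. Qed.

Lemma quad_ge0 (p q m u v : R) : 0 < p -> m * m <= 4 * p * q ->
  0 <= p * (u * u) + q * (v * v) - m * (u * v).
Proof.
move=> p0 h; have : 0 <= 4 * p * (p * (u * u) + q * (v * v) - m * (u * v)).
  have -> : 4 * p * (p * (u * u) + q * (v * v) - m * (u * v)) =
    (2 * p * u - m * v) * (2 * p * u - m * v) + (4 * p * q - m * m) * (v * v).
    by ring.
  apply: addr_ge0; first exact: mul_self_ge0.
  by apply: mulr_ge0; [rewrite subr_ge0|exact: mul_self_ge0].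
by rewrite pmulr_rge0 // mulr_gt0 // ltr0n.
Qed.

(** The form [hess] splits into three binary forms, each diagonal coefficient being shared between
    two of them: [366/5] is halved exactly, while [7307/100] and [133/100] leave a remainder of
    [1/100]. *)
Lemma quad_xy z u v : z * z <= 121 ->
  0 <= 183 / 5 * (u * u) + 3653 / 100 * (v * v) - 6 * z * (u * v).
Proof. by move=> h; apply: quad_ge0; lra. Qed.

Lemma quad_xz y u v : y * y <= 9 / 4 ->
  0 <= 183 / 5 * (u * u) + 33 / 50 * (v * v) - 6 * y * (u * v).
Proof. by move=> h; apply: quad_ge0; lra. Qed.

Lemma quad_yz x u v : x * x <= 9 / 4 ->
  0 <= 3653 / 100 * (u * u) + 33 / 50 * (v * v) - 6 * x * (u * v).
Proof. by move=> h; apply: quad_ge0; lra. Qed.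

Lemma hess_ge0 x y z a b c : box x y z -> 0 <= hess x y z a b c.
Proof.
move=> [hx hy hz]; have := quad_xy a b hz; have := quad_xz a c hy.
have := quad_yz b c hx; have := mul_self_ge0 b; have := mul_self_ge0 c.
by rewrite /hess; lra.
Qed.

(** Let [Q] be the quadratic part and [E = 708/5]. The Hessian in the direction [(x, y, z)] gives
    [Q >= 18 x y z], and [Q - 6 x y z = E] on the surface; hence the radial derivative
    [2 Q - 18 x y z] is at least [3 E / 2]. *)
Lemma dcubic_radial_gt0 x y z : box x y z -> cubic x y z = 0 ->
  0 < dcubic x y z x y z.
Proof.
move=> [hx hy hz]; have := quad_xy x y hz; have := quad_xz x z hy.
have := quad_yz y z hx; have := mul_self_ge0 y; have := mul_self_ge0 z.
by rewrite /cubic /dcubic /cubic_x /cubic_y /cubic_z; lra.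
Qed.

(** This reconciles the two descriptions of the surface: the closed box makes it compact, and the
    open box shows that it is locally a full level set. *)
Lemma cubic_box_strict x y z : box x y z -> cubic x y z = 0 ->
  [/\ x * x < 9 / 4, y * y < 9 / 4 & z * z < 121].
Proof.
rewrite /cubic => -[hx hy hz] h.
have x0 := mul_self_ge0 x; have y0 := mul_self_ge0 y; have z0 := mul_self_ge0 z.
split.
- have := quad_yz y z hx; lra.
- have := quad_xz x z hy; lra.
- have := quad_xy x y hz; lra.
Qed.

(** Needed for the points built from [zroot], for which only bounds on [x] and [y] are given. *)
Lemma cubic_z_bound x y z : x * x <= 9 / 4 -> cubic x y z = 0 ->
  z * z <= 121.
Proof.
move=> hx; rewrite /cubic => h; have x0 := mul_self_ge0 x.
(* A crude bound, then used to control the term [x^2 z^2] produced by eliminating [y]. *)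
have z1 : z * z <= 135.
  have : 0 <= 7307 / 100 * (y * y) + 7 / 25 * (z * z) - 6 * x * (y * z).
    by apply: quad_ge0; [lra|lra].
  lra.
(* Completing the square in [y]: [900/7307] is [36] divided by four times [7307/100]. *)
have q : 0 <= 7307 / 100 * (y * y) + 900 / 7307 * (x * x) * (z * z)
    - 6 * x * (y * z).
  by apply: quad_ge0; [lra|rewrite le_eqVlt; apply/orP; left; apply/eqP; field].
have p : 0 <= (x * x) * (135 - z * z) by rewrite mulr_ge0 // subr_ge0.
lra.
Qed.

(* Exact Taylor formula: the cubic remainder is absorbed by evaluating the
   Hessian at the point two thirds of the way towards the base point. *)
Lemma cubic_taylor a b c x y z :
  cubic x y z = cubic a b c + dcubic a b c (x - a) (y - b) (z - c) +
    hess ((2 * a + x) / 3) ((2 * b + y) / 3) ((2 * c + z) / 3)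
      (x - a) (y - b) (z - c).
Proof. by rewrite /cubic /dcubic /cubic_x /cubic_y /cubic_z /hess; field. Qed.

Lemma box_convex a b c x y z : box a b c -> box x y z ->
  box ((2 * a + x) / 3) ((2 * b + y) / 3) ((2 * c + z) / 3).
Proof.
have cv (m u v : R) : u * u <= m -> v * v <= m ->
    (2 * u + v) / 3 * ((2 * u + v) / 3) <= m.
  by move=> hu hv; have := mul_self_ge0 (u - v); lra.
by move=> [h1 h2 h3] [h4 h5 h6]; split; exact: cv.
Qed.

Lemma cubic_above_tangent a b c x y z : box a b c -> box x y z ->
  cubic a b c + dcubic a b c (x - a) (y - b) (z - c) <= cubic x y z.
Proof.
move=> h1 h2; rewrite (cubic_taylor a b c x y z) lerDl.
exact: hess_ge0 (box_convex h1 h2).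
Qed.

(** The discriminant of [cubic x y z] as a quadratic polynomial in [z]. *)
Definition discr x y : R :=
  36 * ((x * x) * (y * y))
  - 133 / 25 * (366 / 5 * (x * x) + 7307 / 100 * (y * y) - 708 / 5).

Lemma cubic_discr x y z :
  (133 / 50 * z - 6 * (x * y)) * (133 / 50 * z - 6 * (x * y)) =
  discr x y + 133 / 25 * cubic x y z.
Proof. by rewrite /discr /cubic; field. Qed.

(** The part of the domain where the surface has points above [(x, y)] is star-shaped about the
    origin. The quadratic terms of [discr] dominate the quartic one because [x^2 <= 9/4]. *)
Lemma discr_star x y s : x * x <= 9 / 4 -> 0 <= s <= 1 ->
  0 <= discr x y -> 0 <= discr (s * x) (s * y).
Proof.
move=> hx /andP[s0 s1]; set a := x * x in hx *; set b := y * y.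
have -> : discr (s * x) (s * y) = discr x y + (1 - s * s) *
    (133 / 25 * (366 / 5 * a + 7307 / 100 * b) - (1 + s * s) * (36 * (a * b))).
  by rewrite /discr /a /b; field.
move=> h; apply: (addr_ge0 h).
have a0 : 0 <= a := mul_self_ge0 x; have b0 : 0 <= b := mul_self_ge0 y.
have ss0 : 0 <= s * s := mul_self_ge0 s.
have ss : s * s <= 1 by rewrite mulr_ile1.
have ab : a * b <= 9 / 4 * b by rewrite ler_wpM2r.
have ab0 : 0 <= a * b by rewrite mulr_ge0.
apply: mulr_ge0; first lra.
have : s * s * (a * b) <= 1 * (a * b) by rewrite ler_wpM2r.
lra.
Qed.

End CubicPolynomial.

(** * The surface *)

Section CubicDerivatives.
Context {R : realType}.

Lemma is_derive_mull (V : normedModType R) (a : R) (f : V -> R) x v df :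
  is_derive x v f df -> is_derive x v (fun y => a * f y) (a * df).
Proof. by move=> hf; exact: is_deriveZ. Qed.

Lemma is_derive_sub (V : normedModType R) (f g : V -> R) x v df dg :
  is_derive x v f df -> is_derive x v g dg ->
  is_derive x v (fun y => f y - g y) (df - dg).
Proof. by move=> hf hg; exact: is_deriveB. Qed.

Lemma is_derive_cubic (V : normedModType R) (f g h : V -> R) x v df dg dh :
  is_derive x v f df -> is_derive x v g dg -> is_derive x v h dh ->
  is_derive x v (fun y => cubic (f y) (g y) (h y))
    (dcubic (f x) (g x) (h x) df dg dh).
Proof.
move=> hf hg hh; rewrite /cubic.
refine (is_derive_cast (is_derive_sub (is_derive_sub (is_derive_add (is_derive_add
  (is_derive_mull (366 / 5) (is_derive_mul hf hf))
  (is_derive_mull (7307 / 100) (is_derive_mul hg hg)))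
  (is_derive_mull (133 / 100) (is_derive_mul hh hh)))
  (is_derive_mull 6 (is_derive_mul (is_derive_mul hf hg) hh)))
  (is_derive_cst (708 / 5 : R^o) x v)) _).
by rewrite /dcubic /cubic_x /cubic_y /cubic_z; field.
Qed.

Lemma is_derive_dcubic (V : normedModType R) (f g h : V -> R) x v df dg dh :
  is_derive x v f df -> is_derive x v g dg -> is_derive x v h dh ->
  is_derive x v (fun y => dcubic (f y) (g y) (h y) df dg dh)
    (2 * hess (f x) (g x) (h x) df dg dh).
Proof.
move=> hf hg hh; rewrite /dcubic /cubic_x /cubic_y /cubic_z.
refine (is_derive_cast (is_derive_add (is_derive_add
  (is_derive_mulr df (is_derive_sub (is_derive_mull (732 / 5) hf)
    (is_derive_mull 6 (is_derive_mul hg hh))))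
  (is_derive_mulr dg (is_derive_sub (is_derive_mull (7307 / 50) hg)
    (is_derive_mull 6 (is_derive_mul hf hh)))))
  (is_derive_mulr dh (is_derive_sub (is_derive_mull (133 / 50) hh)
    (is_derive_mull 6 (is_derive_mul hf hg))))) _).
by rewrite /hess; field.
Qed.

Lemma is_derive_discr (V : normedModType R) (f g : V -> R) x v df dg :
  is_derive x v f df -> is_derive x v g dg ->
  exists d, is_derive x v (fun y => discr (f y) (g y)) d.
Proof.
move=> hf hg; eexists; rewrite /discr.
exact: (is_derive_sub
  (is_derive_mull 36 (is_derive_mul (is_derive_mul hf hf) (is_derive_mul hg hg)))
  (is_derive_mull (133 / 25) (is_derive_sub (is_derive_add
    (is_derive_mull (366 / 5) (is_derive_mul hf hf))
    (is_derive_mull (7307 / 100) (is_derive_mul hg hg)))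
    (is_derive_cst (708 / 5 : R^o) x v)))).
Qed.

End CubicDerivatives.

Section Surface.
Context {R : realType}.
Implicit Types (X Y v : 'rV[R]_4).

Definition sfun X : R^o := cubic (co 1 X) (co 2 X) (co 3 X).

Definition dsfun X v : R := dcubic (co 1 X) (co 2 X) (co 3 X) (co 1 v) (co 2 v) (co 3 v).

Definition inbox X : Prop := box (co 1 X) (co 2 X) (co 3 X).

Definition surf : set 'rV[R]_4 := [set X | [/\ H3 R X, sfun X = 0 & inbox X]].

Definition open_box : set 'rV[R]_4 := [set X | [/\ 0 < 9 / 4 - co 1 X * co 1 X,
  0 < 9 / 4 - co 2 X * co 2 X & 0 < 121 - co 3 X * co 3 X]].

Lemma surf_open_box X : surf X -> open_box X.
Proof.
by move=> [_ f0 b]; have [h1 h2 h3] := cubic_box_strict b f0; split; rewrite subr_gt0.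
Qed.

Lemma open_box_inbox X : open_box X -> inbox X.
Proof. by move=> [h1 h2 h3]; split; rewrite -subr_ge0 ltW. Qed.

Lemma dsfunD X v w : dsfun X (v + w) = dsfun X v + dsfun X w.
Proof. by rewrite /dsfun /dcubic !coD; ring. Qed.

Lemma dsfunZ X (a : R) v : dsfun X (a *: v) = a * dsfun X v.
Proof. by rewrite /dsfun /dcubic !coZ; ring. Qed.

Lemma dsfun_radial_gt0 X : surf X -> 0 < dsfun X X.
Proof. by move=> [_ f0 b]; exact: dcubic_radial_gt0. Qed.

Lemma is_derive_sfun (V : normedModType R) (c : V -> 'rV[R]_4) (x u : V) dc :
  is_derive x u c dc -> is_derive x u (fun y => sfun (c y)) (dsfun (c x) dc).
Proof.
move=> hc; exact: (is_derive_cubic (is_derive_co 1 hc) (is_derive_co 2 hc)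
  (is_derive_co 3 hc)).
Qed.

Lemma smooth_sfun (U : set 'rV[R]_4) : open U -> smooth_on U sfun.
Proof.
move=> oU.
have [[h1 h2] h3] := (smooth_co 1 oU, smooth_co 2 oU, smooth_co 3 oU).
have hc (a : R) := smooth_cst oU (a : R^o).
rewrite /sfun /cubic.
exact: (smoothB oU (smoothB oU (smoothD oU (smoothD oU
  (smoothMl oU (366 / 5) (smoothM oU h1 h1))
  (smoothMl oU (7307 / 100) (smoothM oU h2 h2)))
  (smoothMl oU (133 / 100) (smoothM oU h3 h3)))
  (smoothMl oU 6 (smoothM oU (smoothM oU h1 h2) h3))) (hc (708 / 5))).
Qed.

Lemma open_gt0 (g : 'rV[R]_4 -> R^o) : smooth_on setT g -> open [set X | 0 < g X].
Proof.
move=> hg; have -> : [set X | 0 < g X] = g @^-1` [set r : R^o | 0 < r] by [].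
apply: open_comp; last exact: open_gt.
by move=> X _; exact: (hg 0%N).
Qed.

Lemma closed_ge0 (g : 'rV[R]_4 -> R^o) : smooth_on setT g -> closed [set X | 0 <= g X].
Proof.
move=> hg; have -> : [set X | 0 <= g X] = g @^-1` [set r : R^o | 0 <= r] by [].
apply: closed_comp; last exact: closed_ge.
by move=> X _; exact: (hg 0%N X I).
Qed.

Lemma smooth_box_fun (U : set 'rV[R]_4) k (a : R) : open U ->
  smooth_on U (fun X => a - co k X * co k X : R^o).
Proof.
move=> oU; have h := smooth_co k oU.
exact: (smoothB oU (smooth_cst oU (a : R^o)) (smoothM oU h h)).
Qed.

Lemma open_open_box : open open_box.
Proof.
have -> : open_box = [set X | 0 < 9 / 4 - co 1 X * co 1 X] `&`
    [set X | 0 < 9 / 4 - co 2 X * co 2 X] `&` [set X | 0 < 121 - co 3 X * co 3 X].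
  by apply/seteqP; split => X; [move=> []|move=> [[]]].
by do !apply: openI; apply: open_gt0; exact: smooth_box_fun openT.
Qed.

Lemma embedded_surf : embedded_surface surf.
Proof.
split=> [X []//|p Sp]; exists open_box, sfun; split.
- exact: open_open_box.
- exact: surf_open_box.
- exact: smooth_sfun open_open_box.
- apply/seteqP; split => X; first by move=> [[hX f0 _] bX].
  by move=> [hX bX f0]; split => //; split => //; exact: open_box_inbox.
- move=> X SX _; have [[XX _] _ _] := SX.
  (* The spatial part of [X]: [sfun] ignores the time coordinate, so [dsfun X w] is the radial
     derivative, and projecting [w] to the tangent space of [H3] adds a nonnegative multiple of
     it. *)
  pose w := vec 0 (co 1 X) (co 2 X) (co 3 X).
  have wX : 0 <= mink w X.
    rewrite mink_co !covE mul0r mulr0 oppr0 add0r.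
    have := mul_self_ge0 (co 1 X); have := mul_self_ge0 (co 2 X).
    by have := mul_self_ge0 (co 3 X); lra.
  exists (w + mink w X *: X).
    by rewrite minkDr minkZr XX mulrN1 minkC subrr.
  have [_ ->] := is_derive_sfun (is_derive_id X (w + mink w X *: X)).
  have h := dsfun_radial_gt0 SX.
  rewrite dsfunD dsfunZ gt_eqF //.
  have -> : dsfun X w = dsfun X X by rewrite /dsfun !covE.
  by rewrite ltr_wpDr // mulr_ge0 // ltW.
Qed.

Lemma tangent_surf X v : tangent_space surf X v -> mink X v = 0 /\ dsfun X v = 0.
Proof.
move=> tv; split; first by apply: tangent_H3 tv => Y [].
case: tv => c [c0 cS dc].
have [_ h] := is_derive_sfun dc.
rewrite -c0 -h (@near_eq_derive R R^o R^o _ (cst 0)) ?derive_cst //.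
by apply: filterS cS => t [].
Qed.

(** The Minkowski gradient of [sfun], whence the divisions by the weights [scale2], projected by
    [tproj X] for [X] in [H3]. *)
Definition snormal X : 'rV[R]_4 :=
  vec 0 (cubic_x (co 1 X) (co 2 X) (co 3 X) / (13 / 385))
    (cubic_y (co 1 X) (co 2 X) (co 3 X) / (247 / (99 * 20)))
    (cubic_z (co 1 X) (co 2 X) (co 3 X) / (71 / (99 * 140)))
  + dsfun X X *: X.

Lemma mink_snormal X v : mink (snormal X) v = dsfun X v + dsfun X X * mink X v.
Proof.
rewrite /snormal minkDl minkZl; congr (_ + _).
by rewrite mink_co !covE /dsfun /dcubic; field.
Qed.

Lemma snormal_gt0 X : surf X -> 0 < mink (snormal X) (snormal X).
Proof.
move=> SX; have [[XX _] _ _] := SX; have h := dsfun_radial_gt0 SX.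
rewrite mink_snormal (minkC X) mink_snormal XX mulrN1 subrr mulr0 addr0.
rewrite /snormal dsfunD dsfunZ; apply: ltr_wpDl; last by rewrite mulr_gt0.
rewrite /dsfun /dcubic !covE.
move: (cubic_x _ _ _) (cubic_y _ _ _) (cubic_z _ _ _) => a b c.
by have := mul_self_ge0 a; have := mul_self_ge0 b; have := mul_self_ge0 c; lra.
Qed.

Lemma smooth_snormal (U : set 'rV[R]_4) (i : 'I_4) :
  open U -> smooth_on U (fun X => snormal X 0 i : R^o).
Proof.
move=> oU.
have [[h1 h2] h3] := (smooth_co 1 oU, smooth_co 2 oU, smooth_co 3 oU).
have hc (a : R) := smooth_cst oU (a : R^o).
have gx : smooth_on U (fun X => cubic_x (co 1 X) (co 2 X) (co 3 X) : R^o).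
  rewrite /cubic_x /cubic_y /cubic_z.
  exact: (smoothB oU (smoothMl oU (732 / 5) h1) (smoothMl oU 6 (smoothM oU h2 h3))).
have gy : smooth_on U (fun X => cubic_y (co 1 X) (co 2 X) (co 3 X) : R^o).
  rewrite /cubic_x /cubic_y /cubic_z.
  exact: (smoothB oU (smoothMl oU (7307 / 50) h2) (smoothMl oU 6 (smoothM oU h1 h3))).
have gz : smooth_on U (fun X => cubic_z (co 1 X) (co 2 X) (co 3 X) : R^o).
  rewrite /cubic_x /cubic_y /cubic_z.
  exact: (smoothB oU (smoothMl oU (133 / 50) h3) (smoothMl oU 6 (smoothM oU h1 h2))).
have hr : smooth_on U (fun X => dsfun X X : R^o).
  exact: (smoothD oU (smoothD oU (smoothM oU gx h1) (smoothM oU gy h2))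
    (smoothM oU gz h3)).
have hi : smooth_on U (fun X => X 0 i : R^o).
  have := smooth_crd oU i; rewrite (_ : crd i = (fun X => X 0 i)) //.
  by apply/funext => X; rewrite /crd inord_val.
have -> : (fun X => snormal X 0 i : R^o) = (fun X => sc i * nth 0 [:: 0;
    cubic_x (co 1 X) (co 2 X) (co 3 X) / (13 / 385);
    cubic_y (co 1 X) (co 2 X) (co 3 X) / (247 / (99 * 20));
    cubic_z (co 1 X) (co 2 X) (co 3 X) / (71 / (99 * 140))] i + dsfun X X * X 0 i).
  by apply/funext => X; rewrite /snormal !mxE.
apply: smoothD => //; last exact: smoothM.
apply: smoothMl => //; case: i {hi} => -[|[|[|[|//]]]] _ /=.
- exact: hc.
- exact: (smoothM oU gx (hc _)).
- exact: (smoothM oU gy (hc _)).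
- exact: (smoothM oU gz (hc _)).
Qed.

Definition normal_domain : set 'rV[R]_4 :=
  open_box `&` [set X | 0 < mink (snormal X) (snormal X)].

Lemma smooth_snormal2 (U : set 'rV[R]_4) : open U ->
  smooth_on U (fun X => mink (snormal X) (snormal X) : R^o).
Proof.
move=> oU; have h k := smooth_snormal (inord k) oU.
have hm k := smoothM oU (h k) (h k).
have -> : (fun X => mink (snormal X) (snormal X) : R^o) = (fun X =>
   -1 * (snormal X 0 (inord 0) * snormal X 0 (inord 0)) +
   (snormal X 0 (inord 1) * snormal X 0 (inord 1) +
    snormal X 0 (inord 2) * snormal X 0 (inord 2) +
    snormal X 0 (inord 3) * snormal X 0 (inord 3))).
  by apply/funext => X; rewrite minkE mulN1r.
exact: (smoothD oU (smoothMl oU (-1) (hm 0%N))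
  (smoothD oU (smoothD oU (hm 1%N) (hm 2%N)) (hm 3%N))).
Qed.

Lemma open_normal_domain : open normal_domain.
Proof.
apply: openI; first exact: open_open_box.
exact: (open_gt0 (smooth_snormal2 openT)).
Qed.

Definition unit_snormal X : 'rV[R]_4 :=
  (Num.sqrt (mink (snormal X) (snormal X)))^-1 *: snormal X.

Lemma smooth_unit_snormal : smooth_on normal_domain unit_snormal.
Proof.
have oU := open_normal_domain.
apply: smooth_mx => // i.
have -> : (fun X => unit_snormal X 0 i : R^o) = (fun X => snormal X 0 i *
    (Num.sqrt (mink (snormal X) (snormal X)))^-1 ^+ 1).
  by apply/funext => X; rewrite /unit_snormal mxE expr1 mulrC.
apply: (smooth_mul_isqrt oU 1 (smooth_snormal2 oU)); first by move=> X [].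
exact: smooth_snormal.
Qed.

Lemma unit_normal_surf : unit_normal_on surf normal_domain unit_snormal.
Proof.
split; first exact: smooth_unit_snormal.
move=> X SX [_ g0]; have [[XX _] _ _] := SX; split.
- by rewrite minkZr (minkC X) (mink_snormal X X) XX mulrN1 subrr mulr0.
- rewrite minkZl minkZr -{3}(sqr_sqrtr (ltW g0)); field.
  by rewrite gt_eqF // sqrtr_gt0.
- by move=> v /tangent_surf [Xv dv]; rewrite minkZl (mink_snormal X v) Xv dv mulr0 addr0 mulr0.
Qed.

(** With [v] fixed, [mink (snormal Y) v] has at [X] the derivative [2 hess + dsfun X X * mink v v].
    The last term comes from the curvature of the hyperboloid and makes the form definite even where
    the Hessian degenerates. *)
Lemma definite_surf X : surf X ->
  definite_on (tangent_space surf X) (shape_operator unit_snormal X).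
Proof.
move=> SX; right => v /tangent_surf [Xv dv] v0.
have [HX f0 bX] := SX; have UX : normal_domain X.
  by split; [exact: surf_open_box|exact: snormal_gt0].
have g0 := snormal_gt0 SX.
have dN := derivableP (smooth_derivable (v := v) smooth_unit_snormal UX).
have dg := derivableP (smooth_derivable (v := v) (smooth_snormal2 openT) (I : setT X)).
have dr := is_derive_isqrt (g := fun Y => mink (snormal Y) (snormal Y)) g0 dg.
have did := is_derive_id X v.
(* Existence is enough here: the value gets multiplied by [mink X v = 0]. *)
have dh : derivable (fun Y => dsfun Y Y : R^o) X v.
  have c1 := is_derive_co 1 did; have c2 := is_derive_co 2 did.
  have c3 := is_derive_co 3 did.
  have d1 := is_derive_sub (is_derive_mull (732 / 5) c1)
    (is_derive_mull 6 (is_derive_mul c2 c3)).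
  have d2 := is_derive_sub (is_derive_mull (7307 / 50) c2)
    (is_derive_mull 6 (is_derive_mul c1 c3)).
  have d3 := is_derive_sub (is_derive_mull (133 / 50) c3)
    (is_derive_mull 6 (is_derive_mul c1 c2)).
  by have [] := is_derive_add (is_derive_add (is_derive_mul d1 c1)
    (is_derive_mul d2 c2)) (is_derive_mul d3 c3).
have dl : is_derive X v (fun Y => dsfun Y v + dsfun Y Y * mink Y v)
    (2 * hess (co 1 X) (co 2 X) (co 3 X) (co 1 v) (co 2 v) (co 3 v)
     + dsfun X X * mink v v).
  refine (is_derive_cast (is_derive_add
    (is_derive_dcubic (is_derive_co 1 did) (is_derive_co 2 did) (is_derive_co 3 did))
    (is_derive_mul (derivableP dh) (is_derive_mink did (is_derive_cst v X v)))) _).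
  by rewrite Xv mink0r mulr0 add0r addr0.
have e1 : mink ('D_v unit_snormal X) v =
    (Num.sqrt (mink (snormal X) (snormal X)))^-1 *
    (2 * hess (co 1 X) (co 2 X) (co 3 X) (co 1 v) (co 2 v) (co 3 v)
     + dsfun X X * mink v v).
  have [_ h1] := is_derive_mink dN (is_derive_cst v X v).
  have [_ h2] := is_derive_mul dr dl.
  move: h1; rewrite mink0r addr0 => <-.
  have -> : (fun Y => mink (unit_snormal Y) (cst v Y)) = (fun Y =>
      (Num.sqrt (mink (snormal Y) (snormal Y)))^-1 *
      (dsfun Y v + dsfun Y Y * mink Y v)).
    by apply/funext => Y; rewrite minkZl (mink_snormal Y v).
  (* The derivative of the normalizing factor multiplies [mink (snormal X) v], which is [0]. *)
  by rewrite h2 Xv dv mulr0 addr0 mulr0 add0r.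
rewrite /shape_operator /tproj minkNl minkDl minkZl Xv mulr0 addr0 e1 oppr_lt0.
have vv : 0 < mink v v by apply: mink_spacelike_gt0 v0; [exact: HX.1|exact: Xv].
apply: mulr_gt0; first by rewrite invr_gt0 sqrtr_gt0.
apply: ltr_wpDl; first by rewrite mulr_ge0 // hess_ge0.
by rewrite mulr_gt0 // dsfun_radial_gt0.
Qed.

Lemma quadratically_convex_surf : quadratically_convex surf.
Proof.
move=> X SX; exists normal_domain, unit_snormal; split.
- exact: open_normal_domain.
- by split; [exact: surf_open_box|exact: snormal_gt0].
- exact: unit_normal_surf.
- exact: definite_surf.
Qed.

End Surface.

(** * Compactness and connectedness of the surface *)

Section SurfaceTopology.
Context {R : realType}.
Implicit Types (X Y v : 'rV[R]_4).

Lemma surf_crd_bound X k : surf X -> (k < 4)%N -> crd k X * crd k X <= 4.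
Proof.
move=> [[XX _] _ [b1 b2 b3]] k4.
have h1 := crdM X X (isT : (1 < 4)%N); have h2 := crdM X X (isT : (2 < 4)%N).
have h3 := crdM X X (isT : (3 < 4)%N); move: h1 h2 h3 => /= h1 h2 h3.
move: XX; rewrite minkE => XX.
by case: k k4 => [|[|[|[|//]]]] _; lra.
Qed.

Lemma bounded_surf : bounded_set (surf : set 'rV[R]_4).
Proof.
exists 2; split; first by rewrite num_real.
move=> M M2 X SX; apply: le_trans (ltW M2).
rewrite /Num.Def.normr/= mx_normrE (bigmax_le _ (ler0n _ _))//= => -[i j] _ /=.
rewrite (ord1 i) -(inord_val j) -[X 0 _]/(crd j X).
have := surf_crd_bound SX (ltn_ord j); move: (crd j X) => a h.
by rewrite ler_norml; apply/andP; split; nra.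
Qed.

Lemma smooth_minkxx (U : set 'rV[R]_4) : open U ->
  smooth_on U (fun X => mink X X : R^o).
Proof.
move=> oU; have h k := smooth_crd oU k; have hm k := smoothM oU (h k) (h k).
have -> : (fun X => mink X X : R^o) = (fun X => -1 * (crd 0 X * crd 0 X) +
    (crd 1 X * crd 1 X + crd 2 X * crd 2 X + crd 3 X * crd 3 X)).
  by apply/funext => X; rewrite minkE mulN1r.
exact: (smoothD oU (smoothMl oU (-1) (hm 0%N))
  (smoothD oU (smoothD oU (hm 1%N) (hm 2%N)) (hm 3%N))).
Qed.

Lemma closed_surf : closed (surf : set 'rV[R]_4).
Proof.
have oT : open (setT : set 'rV[R]_4) := openT.
have hm := smooth_minkxx oT; have hf := smooth_sfun oT.
have hc (a : R) := smooth_cst oT (a : R^o).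
(* Only closed conditions appear: [0 < crd 0 X] is weakened to [0 <= crd 0 X], since [mink X X = -1]
   excludes [crd 0 X = 0]. *)
have -> : surf = [set X : 'rV[R]_4 | 0 <= mink X X - (-1)] `&`
   [set X : 'rV[R]_4 | 0 <= -1 - mink X X] `&` [set X : 'rV[R]_4 | 0 <= crd 0 X] `&`
   [set X : 'rV[R]_4 | 0 <= sfun X] `&` [set X : 'rV[R]_4 | 0 <= -1 * sfun X] `&`
   [set X : 'rV[R]_4 | 0 <= 9 / 4 - co 1 X * co 1 X] `&`
   [set X : 'rV[R]_4 | 0 <= 9 / 4 - co 2 X * co 2 X] `&`
   [set X : 'rV[R]_4 | 0 <= 121 - co 3 X * co 3 X].
  apply/seteqP; split => X.
    move=> [/H3P [XX X0] f0 [b1 b2 b3]]; rewrite /= XX f0 mulr0 subrr !subr_ge0.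
    by do !split => //; exact: ltW.
  move=> [[[[[[[h1 h2] h3] h4] h5] h6] h7] h8]; move: h1 h2 h3 h6 h7 h8.
  rewrite /= !subr_ge0 => h1 h2 h3 h6 h7 h8.
  rewrite /= mulN1r oppr_ge0 in h5.
  have XX : mink X X = -1 by apply/le_anti/andP.
  split; [|by apply/eqP; rewrite eq_le h5 h4|by []].
  apply/H3P; split => //; rewrite lt_neqAle h3 andbT eq_sym; apply/eqP => X0.
  move: XX; rewrite minkE X0 => XX; have := mul_self_ge0 (crd 1 X).
  by have := mul_self_ge0 (crd 2 X); have := mul_self_ge0 (crd 3 X); lra.
have hb k (a : R) := smooth_box_fun k a oT.
do !apply: closedI.
- exact: (closed_ge0 (smoothB oT hm (hc (-1)))).
- exact: (closed_ge0 (smoothB oT (hc (-1)) hm)).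
- exact: (closed_ge0 (smooth_crd oT 0)).
- exact: (closed_ge0 hf).
- exact: (closed_ge0 (smoothMl oT (-1) hf)).
- exact: (closed_ge0 (hb 1%N (9 / 4))).
- exact: (closed_ge0 (hb 2%N (9 / 4))).
- exact: (closed_ge0 (hb 3%N 121)).
Qed.

Lemma compact_surf : compact (surf : set 'rV[R]_4).
Proof. exact: bounded_closed_compact bounded_surf closed_surf. Qed.

Definition tcoord2 (x y z : R) : R := (1 + 13 / 385 * (x * x) +
  247 / (99 * 20) * (y * y) + 71 / (99 * 140) * (z * z)) * (55 / 64).

(** Inverse of the projection of [H3] onto its spatial coordinates. *)
Definition lift3 (x y z : R) : 'rV[R]_4 := vec (Num.sqrt (tcoord2 x y z)) x y z.

Lemma tcoord2_gt0 x y z : 0 < tcoord2 x y z.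
Proof.
rewrite /tcoord2; have := mul_self_ge0 x; have := mul_self_ge0 y; have := mul_self_ge0 z.
lra.
Qed.

Lemma H3_lift3 x y z : H3 R (lift3 x y z).
Proof.
apply/H3P; rewrite crd0_gt0 mink_co !covE -expr2.
rewrite sqr_sqrtr ?(ltW (tcoord2_gt0 _ _ _)) // sqrtr_gt0 tcoord2_gt0.
by split => //; rewrite /tcoord2; field.
Qed.

Lemma H3_lift3E X : H3 R X -> X = lift3 (co 1 X) (co 2 X) (co 3 X).
Proof.
move=> /H3P []; rewrite crd0_gt0 mink_co => XX X0.
apply: coP; rewrite /lift3 !covE //.
have -> : tcoord2 (co 1 X) (co 2 X) (co 3 X) = co 0 X ^+ 2.
  by rewrite /tcoord2 expr2; lra.
by rewrite sqrtr_sqr gtr0_norm.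
Qed.

(* For [e = 1] and [e = -1], the two sheets of the surface over the [(x, y)]-plane. *)
Definition zroot (e x y : R) : R :=
  (6 * (x * y) + Num.sqrt (discr x y) * e) * (50 / 133).

Lemma surf_zroot e x y : e * e = 1 -> x * x <= 9 / 4 -> y * y <= 9 / 4 ->
  0 <= discr x y -> surf (lift3 x y (zroot e x y)).
Proof.
move=> ee hx hy hd.
have f0 : cubic x y (zroot e x y) = 0.
  have := cubic_discr x y (zroot e x y).
  have -> : 133 / 50 * zroot e x y - 6 * (x * y) = Num.sqrt (discr x y) * e.
    by rewrite /zroot; field.
  rewrite mulrACA ee mulr1 -expr2 sqr_sqrtr // => h.
  move: (cubic _ _ _) h => c h; lra.
split; rewrite /inbox /sfun ?covE //; first exact: H3_lift3.
by split => //; exact: cubic_z_bound f0.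
Qed.

Lemma surf_discr X : surf X -> discr (co 1 X) (co 2 X) =
  (133 / 50 * co 3 X - 6 * (co 1 X * co 2 X)) *
  (133 / 50 * co 3 X - 6 * (co 1 X * co 2 X)).
Proof. by move=> [_ f0 _]; rewrite cubic_discr -[cubic _ _ _]/(sfun X) f0 mulr0 addr0. Qed.

Lemma zroot_surf e X : surf X -> e * e = 1 ->
  0 <= e * (133 / 50 * co 3 X - 6 * (co 1 X * co 2 X)) ->
  co 3 X = zroot e (co 1 X) (co 2 X).
Proof.
move=> SX ee; have := surf_discr SX.
set w := _ - _ => dE w0.
have -> : zroot e (co 1 X) (co 2 X) = (6 * (co 1 X * co 2 X) + w) * (50 / 133).
  rewrite /zroot dE; congr ((_ + _) * _).
  have -> : w * w = (e * w) ^+ 2 by rewrite expr2 mulrACA ee mul1r.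
  by rewrite sqrtr_sqr ger0_norm // mulrAC ee mul1r.
by rewrite /w; field.
Qed.

Lemma continuous_lift3 (T : topologicalType) (f g h : T -> R^o) x :
  {for x, continuous f} -> {for x, continuous g} -> {for x, continuous h} ->
  {for x, continuous (fun t => lift3 (f t) (g t) (h t))}.
Proof.
move=> hf hg hh; apply: continuous_vec => //.
apply: (@continuous_comp _ _ _ (fun t => tcoord2 (f t) (g t) (h t) : R^o)
  (@Num.sqrt R)); last exact: sqrt_continuous.
have hc (a : R) : {for x, continuous (fun=> a : R^o)} by exact: cst_continuous.
have hm (a : R) (u : T -> R^o) : {for x, continuous u} ->
    {for x, continuous (fun t : T => a * (u t * u t) : R^o)}.
  by move=> hu; exact: (continuousM (hc a) (continuousM hu hu)).
exact: (continuousM (continuousD (continuousD (continuousD (hc 1)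
  (hm (13 / 385) f hf)) (hm (247 / (99 * 20)) g hg))
  (hm (71 / (99 * 140)) h hh)) (hc (55 / 64))).
Qed.

(** The expression multiplied by [e] is [cubic_z], whose sign tells the two roots in [z] apart. *)
Definition sheet (e : R) : set 'rV[R]_4 :=
  [set X | surf X /\ 0 <= e * (133 / 50 * co 3 X - 6 * (co 1 X * co 2 X))].

(** The sheet is a graph over a star-shaped region, so each point is joined to the point above the
    origin by lifting a ray. *)
Lemma connected_sheet e : e * e = 1 -> connected (sheet e).
Proof.
move=> ee; apply: (path_connected_set (p := lift3 0 0 (zroot e 0 0))).
move=> X [SX Xe]; have [HX _ [bx bY _]] := SX.
set x := co 1 X in bx Xe; set y := co 2 X in bY Xe.
have dX : 0 <= discr x y by rewrite surf_discr // mul_self_ge0.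
exists (fun s : R => lift3 (s * x) (s * y) (zroot e (s * x) (s * y))); split.
- by rewrite !mul0r.
- by rewrite !mul1r -(zroot_surf SX ee Xe) -H3_lift3E.
- move=> s s01; have dS := discr_star bx s01 dX.
  have sb u : u * u <= 9 / 4 -> s * u * (s * u) <= 9 / 4.
    move=> hu; rewrite mulrACA; apply: le_trans hu.
    have /andP[s0 s1] := s01.
    by rewrite ler_piMl ?mul_self_ge0 // mulr_ile1.
  split; first by apply: surf_zroot => //; exact: sb.
  rewrite /lift3 !covE.
  have -> : 133 / 50 * zroot e (s * x) (s * y) - 6 * (s * x * (s * y)) =
      Num.sqrt (discr (s * x) (s * y)) * e.
    by rewrite /zroot; field.
  by rewrite mulrCA ee mulr1 sqrtr_ge0.
- move=> t _; have did := is_derive_id t (1 : R^o).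
  have hx := is_derive_mulr x did; have hy := is_derive_mulr y did.
  have cont (f : R -> R) df : is_derive t 1 f df -> {for t, continuous f}.
    by move=> [d _]; apply: differentiable_continuous; exact/derivable1_diffP.
  have [dd hd] := is_derive_discr hx hy.
  have cd : {for t, continuous (fun s : R => Num.sqrt (discr (s * x) (s * y)))}.
    by apply: continuous_comp; [exact: cont hd|exact: sqrt_continuous].
  apply: continuous_lift3; [exact: cont hx|exact: cont hy|].
  have hc (a : R) : {for t, continuous (fun=> a : R^o)} by exact: cst_continuous.
  have cxy := cont _ _ (is_derive_mull 6 (is_derive_mul hx hy)).
  exact: (continuousM (continuousD cxy (continuousM cd (hc e))) (hc (50 / 133))).
Qed.

Lemma connected_surf : connected (surf : set 'rV[R]_4).
Proof.
have -> : surf = sheet 1 `|` sheet (-1).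
  apply/seteqP; split => X; last by move=> [[]|[]].
  move=> SX; set w := 133 / 50 * co 3 X - 6 * (co 1 X * co 2 X).
  have [w0|w0] := leP 0 w.
    by left; split => //; rewrite mul1r.
  by right; split => //; rewrite mulN1r oppr_ge0 ltW.
apply: connectedU; last 2 first.
- by apply: connected_sheet; rewrite mulr1.
- by apply: connected_sheet; rewrite mulrNN mulr1.
(* the two sheets meet along the zero set of the discriminant *)
pose x : R := Num.sqrt (118 / 61).
(* [118/61] is [708/5] divided by [366/5], so [(x, 0, 0)] is on the cubic and [cubic_z] vanishes
   there. *)
have xx : x * x = 118 / 61 by rewrite -expr2 sqr_sqrtr //; lra.
exists (lift3 x 0 0); have SX : surf (lift3 x 0 0).
  have f0 : cubic x 0 0 = 0 by rewrite /cubic xx; field.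
  split; rewrite /inbox /sfun ?covE //; first exact: H3_lift3.
  by split; rewrite ?xx ?mulr0; lra.
by split; split => //; rewrite /lift3 !covE !mulr0 subrr mulr0.
Qed.

Lemma closed_surface_surf : closed_surface (surf : set 'rV[R]_4).
Proof.
split.
- exact: embedded_surf.
- have [X SX] : sheet 1 !=set0.
    have d0 : 0 <= discr 0 0 :> R by rewrite /discr !mulr0; lra.
    exists (lift3 0 0 (zroot 1 0 0)).
    have b0 : (0 : R) * 0 <= 9 / 4 by rewrite mulr0; lra.
    split; first by apply: surf_zroot => //; rewrite mulr1.
    rewrite /lift3 !covE /zroot.
    by have := sqrtr_ge0 (discr 0 0 : R); lra.
  by exists X; case: SX.
- exact: compact_surf.
- exact: connected_surf.
Qed.

End SurfaceTopology.

(** * Contact with the four planes *)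

Section ContactPoints.
Context {R : realType}.
Implicit Types (s : R) (v : 'rV[R]_4).

Definition contact s1 s2 s3 : 'rV[R]_4 := vec 1 s1 s2 s3.

(** The vector dual to the covector [(-168, 78 s1, 91 s2, - s3)]; the contact point lies on its
    plane because [78 + 91 - 1 = 168]. *)
Definition wall s1 s2 s3 : 'rV[R]_4 :=
  vec (168 / (64 / 55)) (78 * s1 / (13 / 385)) (91 * s2 / (247 / (99 * 20)))
    (- s3 / (71 / (99 * 140))).

Lemma mink_wall s1 s2 s3 v : mink (wall s1 s2 s3) v =
  - (168 * co 0 v) + (78 * s1 * co 1 v + 91 * s2 * co 2 v - s3 * co 3 v).
Proof. by rewrite mink_co /wall !covE; field. Qed.

Variables s1 s2 s3 : R.
Hypotheses (h1 : s1 * s1 = 1) (h2 : s2 * s2 = 1) (h3 : s3 * s3 = 1).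
Hypothesis h12 : s1 * s2 = s3.

Lemma wall_spacelike : 0 < mink (wall s1 s2 s3) (wall s1 s2 s3).
Proof.
rewrite mink_wall /wall !covE.
have -> : 78 * s1 * (78 * s1 / (13 / 385)) = 78 * 78 * 385 / 13 * (s1 * s1).
  by field.
have -> : 91 * s2 * (91 * s2 / (247 / (99 * 20))) =
  91 * 91 * (99 * 20) / 247 * (s2 * s2) by field.
have -> : s3 * (- s3 / (71 / (99 * 140))) = - (99 * 140) / 71 * (s3 * s3).
  by field.
by rewrite h1 h2 h3; lra.
Qed.

Lemma contact_sign13 : s1 * s3 = s2.
Proof. by rewrite -h12 mulrA h1 mul1r. Qed.

Lemma contact_sign23 : s2 * s3 = s1.
Proof. by rewrite -h12 mulrCA h2 mulr1. Qed.

Lemma contact_box : box s1 s2 s3.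
Proof. by split; rewrite ?h1 ?h2 ?h3; lra. Qed.

Lemma cubic_contact : cubic s1 s2 s3 = 0.
Proof. by rewrite /cubic h12 h1 h2 h3; field. Qed.

Lemma contact_surf : surf (contact s1 s2 s3).
Proof.
split; rewrite /inbox /sfun ?covE.
- apply/H3P; rewrite crd0_gt0 mink_co !covE h1 h2 h3; split => //.
  by field.
- exact: cubic_contact.
- exact: contact_box.
Qed.

(** On the tangent space of [H3] at the contact point, where the last term vanishes, the
    differential is a multiple of [wall]: this is the tangency. The factor [1155/8] is the one that
    cancels the time coordinate, on which [sfun] does not depend. *)
Lemma dsfun_contact v : dsfun (contact s1 s2 s3) v =
  48 / 25 * (mink (wall s1 s2 s3) v - 1155 / 8 * mink (contact s1 s2 s3) v).
Proof.
rewrite mink_wall mink_co /dsfun /contact !covE /dcubic /cubic_x /cubic_y /cubic_z.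
by rewrite h12 contact_sign13 contact_sign23; field.
Qed.

Lemma near_gt0 (f : R -> R) df : is_derive (0 : R) 1 f df -> 0 < f 0 ->
  \forall t \near (0 : R), 0 < f t.
Proof.
move=> [d _] f0.
have cf : {for 0, continuous f}.
  by apply: differentiable_continuous; exact/derivable1_diffP.
by have /cvgr_gt := cf; apply.
Qed.

(* Near the contact point the surface is a graph over the [(x, y)]-plane, so the
   tangent vectors of the surface exhaust the plane cut out by the 1-jets. *)
Lemma tangent_contact : tangent_space surf (contact s1 s2 s3) =
  [set v | mink (contact s1 s2 s3) v = 0 /\ mink (wall s1 s2 s3) v = 0].
Proof.
apply/seteqP; split => v.
  move=> /tangent_surf [pv dv]; split => //; move: dv; rewrite dsfun_contact pv.
  by move: (mink (wall _ _ _) v) => a h; lra.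
move=> [pv Nv].
have dv : dsfun (contact s1 s2 s3) v = 0 by rewrite dsfun_contact pv Nv !mulr0 subrr mulr0.
have did := is_derive_id (0 : R^o) (1 : R^o).
have hx : is_derive (0 : R) 1 (fun t : R => s1 + t * co 1 v) (co 1 v).
  refine (is_derive_cast (is_derive_add (is_derive_cst (s1 : R^o) (0 : R^o) (1 : R^o))
    (is_derive_mulr (co 1 v) did)) _).
  by rewrite add0r mul1r.
have hy : is_derive (0 : R) 1 (fun t : R => s2 + t * co 2 v) (co 2 v).
  refine (is_derive_cast (is_derive_add (is_derive_cst (s2 : R^o) (0 : R^o) (1 : R^o))
    (is_derive_mulr (co 2 v) did)) _).
  by rewrite add0r mul1r.
have [dd hd] := is_derive_discr hx hy.
have d0E : discr (s1 + 0 * co 1 v) (s2 + 0 * co 2 v) = (167 / 50) ^+ 2.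
  by rewrite !mul0r !addr0 /discr h1 h2; field.
have d0 : 0 < discr (s1 + 0 * co 1 v) (s2 + 0 * co 2 v).
  by rewrite d0E exprn_gt0 //; lra.
have hs := is_derive_sqrt (g := fun t : R => discr (s1 + t * co 1 v) (s2 + t * co 2 v)) d0 hd.
pose x t := s1 + t * co 1 v; pose y t := s2 + t * co 2 v.
(* At the contact point [cubic_z] is [- (167/50) s3], which selects the sheet of sign [- s3] and
   gives [discr] the value [(167/50)^2]. *)
pose z t := zroot (- s3) (x t) (y t).
have [dz hz] : exists dz, is_derive (0 : R) 1 z dz.
  eexists; rewrite /z /zroot.
  exact: (is_derive_mulr (50 / 133) (is_derive_add
    (is_derive_mull 6 (is_derive_mul hx hy)) (is_derive_mulr (- s3) hs))).
have [dt ht] : exists dt, is_derive (0 : R) 1 (fun t => tcoord2 (x t) (y t) (z t)) dt.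
  eexists; rewrite /tcoord2.
  exact: (is_derive_mulr (55 / 64) (is_derive_add (is_derive_add (is_derive_add
    (is_derive_cst (1 : R^o) (0 : R^o) (1 : R^o))
    (is_derive_mull (13 / 385) (is_derive_mul hx hx)))
    (is_derive_mull (247 / (99 * 20)) (is_derive_mul hy hy)))
    (is_derive_mull (71 / (99 * 140)) (is_derive_mul hz hz)))).
have hts := is_derive_sqrt (g := fun t => tcoord2 (x t) (y t) (z t))
  (tcoord2_gt0 (x 0) (y 0) (z 0)) ht.
have hc := is_derive_vec hts hx hy hz.
set w := vec _ _ _ _ in hc.
have c0 : lift3 (x 0) (y 0) (z 0) = contact s1 s2 s3.
  have -> : z 0 = s3.
    rewrite /z /zroot d0E sqrtr_sqr gtr0_norm; last lra.
    by rewrite /x /y !mul0r !addr0 h12; field.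
  rewrite /x /y !mul0r !addr0 (H3_lift3E (X := contact s1 s2 s3)) ?covE //.
  by have [] := contact_surf.
have cS : \forall t \near (0 : R), surf (lift3 (x t) (y t) (z t)).
  have bx : \forall t \near (0 : R), 0 < 9 / 4 - x t * x t.
    apply: (near_gt0 (is_derive_sub (is_derive_cst (9 / 4 : R^o) (0 : R^o) (1 : R^o))
      (is_derive_mul hx hx))).
    by rewrite /cst mul0r addr0 h1; lra.
  have bY : \forall t \near (0 : R), 0 < 9 / 4 - y t * y t.
    apply: (near_gt0 (is_derive_sub (is_derive_cst (9 / 4 : R^o) (0 : R^o) (1 : R^o))
      (is_derive_mul hy hy))).
    by rewrite /cst mul0r addr0 h2; lra.
  have bd := near_gt0 hd d0.
  apply: filterS (filterI bx (filterI bY bd)) => t [b1 [b2 b3]].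
  apply: surf_zroot; first by rewrite mulrNN.
  - by rewrite -subr_ge0; exact: ltW b1.
  - by rewrite -subr_ge0; exact: ltW b2.
  - exact: ltW b3.
have wt : tangent_space surf (contact s1 s2 s3) w by exists (fun t => lift3 (x t) (y t) (z t)).
have [pw dw] := tangent_surf wt.
(* Both vectors have the same [co 1] and [co 2]; then [co 3] is determined by [dsfun = 0], as
   [cubic_z] is nonzero, and [co 0] by orthogonality to the contact point. *)
suff -> : v = w by [].
have w1 : co 1 w = co 1 v by rewrite /w covE.
have w2 : co 2 w = co 2 v by rewrite /w covE.
have w3 : co 3 v = co 3 w.
  move: dw dv; rewrite /dsfun /dcubic w1 w2 => <- /addrI.
  have -> : cubic_z (co 1 (contact s1 s2 s3)) (co 2 (contact s1 s2 s3))
      (co 3 (contact s1 s2 s3)) = - (167 / 50) * s3.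
    by rewrite /cubic_z /contact !covE h12; field.
  move: (co 3 v) (co 3 w) => a b h; have e : s3 * a = s3 * b by lra.
  by rewrite -[a]mul1r -[b]mul1r -h3 -!mulrA e.
apply: coP => //.
move: pv; rewrite -pw !mink_co w1 w2 w3 => /addIr.
by rewrite /contact co0v; move: (co 0 v) (co 0 w) => a b h; lra.
Qed.

(* A point [x] of the surface on the plane would satisfy
   [0 = cubic x >= dcubic p (x - p) = c (- mink p x - 1)], [c > 0]. *)
Lemma contact_only v : surf v -> mink (wall s1 s2 s3) v = 0 ->
  - mink (contact s1 s2 s3) v <= 1.
Proof.
move=> [Hv fv bv] Nv.
have := cubic_above_tangent contact_box bv.
rewrite cubic_contact add0r -[cubic _ _ _]/(sfun v) fv.
have -> : dcubic s1 s2 s3 (co 1 v - s1) (co 2 v - s2) (co 3 v - s3) =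
    dsfun (contact s1 s2 s3) v - dsfun (contact s1 s2 s3) (contact s1 s2 s3).
  by rewrite /dsfun /dcubic /contact !covE; ring.
have [[pp _] _ _] := contact_surf.
rewrite !dsfun_contact Nv pp mink_wall /contact !covE.
have -> : - (168 * 1) + (78 * s1 * s1 + 91 * s2 * s2 - s3 * s3) = 0.
  by rewrite -!(mulrA _ s1) -(mulrA _ s2) h1 h2 h3; ring.
by move: (mink _ v) => a h; lra.
Qed.

End ContactPoints.

(** * The periodic orbit *)

Section GeodesicBilliard.
Context {R : realType}.
Implicit Types (S : set 'rV[R]_4) (p q e w N : 'rV[R]_4) (t d : R).

(** On [H3] the product [- mink p x] is the [cosh] of a distance, so for [S] in [H3] the last clause
    says that [S] meets the plane only at [p]. *)
Definition contact_plane S p N := [/\ S p, 0 < mink N N,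
  tangent_space S p = [set v | mink p v = 0 /\ mink N v = 0] &
  forall x, S x -> mink N x = 0 -> - mink p x <= 1].

Definition contact_frame q e p N w t := [/\ line_frame (geod q e t) w,
  mink N q = 0, mink N e = 0, mink N w = 0 & mink q w = 0 /\ mink e w = 0].

Lemma tangent_plane_data_contact S q e N p w t d :
  line_frame q e -> contact_plane S p N -> contact_frame q e p N w t -> 0 <= d ->
  geod (geod q e t) w d = p ->
  tangent_plane_data S (geod q e) (plane N) p t d (geod (geod q e t) w) (fun=> w).
Proof.
move=> lf [Sp N0 tS _] [lfw Nq Ne Nw [qw ew]] d0 pE.
exact: tangent_plane_data_geod.
Qed.

Lemma billiard_data_geod S q e tp d q' w w' N N' p p' :
  line_frame q e -> 0 <= d -> geod q e tp = q' ->
  contact_plane S p' N' -> contact_frame q e p' N' w' tp -> geod q' w' d = p' ->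
  contact_plane S p N -> contact_frame q e p N w 0 -> geod q w d = p ->
  0 < det4 q w' w e ->
  billiard_data S (geod q e) tp d (geod q' w') 0 d (geod q w).
Proof.
move=> lf d0 q'E cp' cf' p'E cp cf pE D.
exists (plane N'), p', (fun=> w'), (plane N), p, (fun=> w); split.
- by rewrite -q'E; apply: tangent_plane_data_contact; rewrite ?q'E.
- rewrite -{2}(geod0 q e).
  by apply: tangent_plane_data_contact; rewrite ?geod0.
- by move=> s; rewrite derive1_geod; exact: pos_frame_geod.
Qed.

(** The line lies in a plane that meets [S] at most at [p], and [p] is at distance [d > 0] from the
    line. *)
Lemma billiard_domain_geod S q e N p w d :
  line_frame q e -> contact_plane S p N -> contact_frame q e p N w 0 -> 0 < d ->
  geod q w d = p -> billiard_domain S (line_of (geod q e)).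
Proof.
move=> lf [_ _ _ Snear] [_ Nq Ne _ [qw ew]] d0 pE; split.
  by exists (geod q e) => //; exact: unit_geodesic_geod.
apply/eqP/negPn/negP => /set0P [x [[b [[t0 bE] [t _ <-]]] Sx]].
have := Snear _ Sx; rewrite bE; set u := t + t0.
have -> : mink N (geod q e u) = 0.
  by rewrite /geod minkDr !minkZr Nq Ne !mulr0 addr0.
move=> /(_ erefl); have [[qq _] _ qe] := lf; have wq : mink w q = 0 by rewrite minkC.
have we : mink w e = 0 by rewrite minkC.
rewrite -pE /geod !(minkDl, minkDr, minkZl, minkZr) qq qe wq we.
by have := cosh_gt1 d0; have := cosh_ge1 u; nra.
Qed.

(** The velocity [e'] at [q'] is orthogonal to [q'] and [w'], so it is transported along the
    perpendicular as a constant vector and serves again as the velocity at [qn]. *)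
Lemma outer_billiard_geod S q e tp d q' e' qn w w' N N' p p' :
  line_frame q e -> 0 <= d -> geod q e tp = q' -> geod e q tp = e' ->
  contact_plane S p' N' -> contact_frame q e p' N' w' tp -> geod q' w' d = p' ->
  contact_plane S p N -> contact_frame q e p N w 0 -> geod q w d = p ->
  0 < det4 q w' w e ->
  geod q' w' (2 * d) = qn -> line_frame qn e' -> mink q' e' = 0 -> mink w' e' = 0 ->
  billiard_domain S (line_of (geod q e)) -> billiard_domain S (line_of (geod qn e')) ->
  outer_billiard S (line_of (geod q e)) (line_of (geod qn e')).
Proof.
move=> lf d0 q'E e'E cp' cf' p'E cp cf pE D qnE lfn qe' we' dom dom'; split => //.
exists (geod q e), tp, d, (geod q' w'), 0, d, (geod q w), (fun=> e'), (geod qn e').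
split.
- by split => //; exact: unit_geodesic_geod.
- exact: (billiard_data_geod lf d0 q'E cp' cf' p'E cp cf pE D).
- by split; [exact: parallel_geod_cst|rewrite derive1_geod].
- by split => //; exact: unit_geodesic_geod.
- by rewrite geod0 derive1_geod geod0.
Qed.

Lemma signed_gap_geod S q e tp d q' w w' :
  line_frame q e ->
  billiard_data S (geod q e) tp d (geod q' w') 0 d (geod q w) ->
  signed_gap S (line_of (geod q e)) tp.
Proof.
move=> lf bd; exists (geod q e), d, (geod q' w'), d, (geod q w); split => //.
exact: unit_geodesic_geod.
Qed.

Lemma det4_co p u v w : det4 p u v w = sc 0 * sc 1 * sc 2 * sc 3 *
  (co 0 p * det3 (co 1 u) (co 2 u) (co 3 u) (co 1 v) (co 2 v) (co 3 v)
    (co 1 w) (co 2 w) (co 3 w)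
  - co 1 p * det3 (co 0 u) (co 2 u) (co 3 u) (co 0 v) (co 2 v) (co 3 v)
    (co 0 w) (co 2 w) (co 3 w)
  + co 2 p * det3 (co 0 u) (co 1 u) (co 3 u) (co 0 v) (co 1 v) (co 3 v)
    (co 0 w) (co 1 w) (co 3 w)
  - co 3 p * det3 (co 0 u) (co 1 u) (co 2 u) (co 0 v) (co 1 v) (co 2 v)
    (co 0 w) (co 1 w) (co 2 w)).
Proof. by rewrite /det4 /det3 !crd_co //; ring. Qed.

Lemma co_geod k q e t : co k (geod q e t) = cosh t * co k q + sinh t * co k e.
Proof. by rewrite coD !coZ. Qed.

End GeodesicBilliard.

(** * The four lines and their billiard data *)

Section Orbit.
Context {R : realType}.
Implicit Types (s e : R).

Definition sign_of s := s = 1 \/ s = -1.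

(* [pole] is the common pole, up to the sign [e], of the two consecutive lines in
   the face [wall]; [footA] and [footB] are the feet on these lines of the
   contact point, [dirA] and [dirB] the unit vectors from one foot towards the
   other. The other faces are obtained by changing two of the signs. *)
Definition pole e s1 s2 : 'rV[R]_4 :=
  vec (e / 12) (e * s1 * (7 / 39)) (e * s2 * (2 / 13)) (e * (s1 * s2) * 14).
Definition footA s1 s2 : 'rV[R]_4 :=
  vec 1 (s1 * (28 / 13)) (s2 / 78) (s1 * s2 * (7 / 6)).
Definition footB s1 s2 : 'rV[R]_4 :=
  vec (7 / 6) (s1 / 78) (s2 * (28 / 13)) (s1 * s2).
Definition dirA s1 s2 : 'rV[R]_4 :=
  vec (- (1 / 5)) (- s1 * (16 / 5)) (s2 * (71 / 30)) (- (s1 * s2) * (19 / 30)).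
Definition dirB s1 s2 : 'rV[R]_4 :=
  vec (- (19 / 30)) (s1 * (71 / 30)) (- s2 * (16 / 5)) (- (s1 * s2) * (1 / 5)).

(** Half the distance between the two feet in a face, then the signed distances from [q_-] to [q_+]
    on the two kinds of lines. The negative sign of [gapB] reflects the alternating orientations. *)
Definition touch : R := ln (3 / 2).
Definition gapA : R := ln (13 / 11).
Definition gapB : R := - ln (15 / 13).

Lemma touch_gt0 : 0 < touch.
Proof. by rewrite /touch ln_gt0 //; lra. Qed.

Lemma cosh_touch : cosh touch = 13 / 12.
Proof. by rewrite /touch cosh_ln; [field|lra]. Qed.

Lemma sinh_touch : sinh touch = 5 / 12.
Proof. by rewrite /touch sinh_ln; [field|lra]. Qed.

Lemma touch2 : 2 * touch = ln (9 / 4).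
Proof.
have -> : 9 / 4 = 3 / 2 * (3 / 2) :> R by field.
by rewrite lnM ?posrE; [rewrite /touch; ring|lra|lra].
Qed.

Lemma cosh_touch2 : cosh (2 * touch) = 97 / 72.
Proof. by rewrite touch2 cosh_ln; [field|lra]. Qed.

Lemma sinh_touch2 : sinh (2 * touch) = 65 / 72.
Proof. by rewrite touch2 sinh_ln; [field|lra]. Qed.

Lemma cosh_gapA : cosh gapA = 145 / 143.
Proof. by rewrite /gapA cosh_ln; [field|lra]. Qed.

Lemma sinh_gapA : sinh gapA = 24 / 143.
Proof. by rewrite /gapA sinh_ln; [field|lra]. Qed.

Lemma cosh_gapB : cosh gapB = 197 / 195.
Proof. by rewrite /gapB coshN cosh_ln; [field|lra]. Qed.

Lemma sinh_gapB : sinh gapB = - (28 / 195).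
Proof. by rewrite /gapB sinhN sinh_ln; [field|lra]. Qed.

Section Faces.
Variables s1 s2 : R.
Hypotheses (h1 : sign_of s1) (h2 : sign_of s2).

Ltac signs := let e1 := fresh in let e2 := fresh in
  destruct h1 as [e1|e1]; destruct h2 as [e2|e2]; rewrite ?e1 ?e2.
Ltac mink_num := rewrite mink_co !covE; signs; field.

Lemma sign_sqr s : sign_of s -> s * s = 1.
Proof. by case=> ->; rewrite ?mulrNN mulr1. Qed.

Lemma sign_opp s : sign_of s -> sign_of (- s).
Proof. by case=> ->; [right|left; rewrite opprK]. Qed.

Lemma contact_plane_wall :
  contact_plane surf (contact s1 s2 (s1 * s2)) (wall s1 s2 (s1 * s2)).
Proof.
have e1 := sign_sqr h1; have e2 := sign_sqr h2.
have e3 : s1 * s2 * (s1 * s2) = 1 by rewrite mulrACA e1 e2 mulr1.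
split.
- exact: contact_surf.
- exact: wall_spacelike.
- exact: tangent_contact.
- by move=> x; exact: contact_only.
Qed.

Lemma H3_footA : H3 R (footA s1 s2).
Proof.
apply/H3P; split; first by rewrite /footA; mink_num.
by rewrite crd0_gt0 /footA covE ltr01.
Qed.

Lemma H3_footB : H3 R (footB s1 s2).
Proof.
apply/H3P; split; first by rewrite /footB; mink_num.
by rewrite crd0_gt0 /footB covE; lra.
Qed.

Lemma line_frameA : line_frame (footA s1 s2) (pole (-1) s1 s2).
Proof. by split; [exact: H3_footA|rewrite /pole; mink_num|
  rewrite /footA /pole; mink_num]. Qed.

Lemma line_frameB : line_frame (footB s1 s2) (pole 1 s1 s2).
Proof. by split; [exact: H3_footB|rewrite /pole; mink_num|
  rewrite /footB /pole; mink_num]. Qed.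

Lemma line_frameA' : line_frame (footA s1 s2) (dirA s1 s2).
Proof. by split; [exact: H3_footA|rewrite /dirA; mink_num|
  rewrite /footA /dirA; mink_num]. Qed.

Lemma line_frameB' : line_frame (footB s1 s2) (dirB s1 s2).
Proof. by split; [exact: H3_footB|rewrite /dirB; mink_num|
  rewrite /footB /dirB; mink_num]. Qed.

(** The line joins the poles of the faces [(s1, s2)] and [(s1, - s2)]. At the foot in a face the
    pole of that face is tangent to the line, so it leaves the first foot with minus one pole as
    velocity and reaches the second with the other pole. *)
Lemma geod_gapA : geod (footA s1 s2) (pole (-1) s1 s2) gapA = footA s1 (- s2).
Proof. by rewrite /footA /pole; apply: coP;
  rewrite co_geod !covE cosh_gapA sinh_gapA; field. Qed.

Lemma geod_gapA' : geod (pole (-1) s1 s2) (footA s1 s2) gapA = pole 1 s1 (- s2).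
Proof. by rewrite /footA /pole; apply: coP;
  rewrite co_geod !covE cosh_gapA sinh_gapA; field. Qed.

Lemma geod_gapB : geod (footB s1 s2) (pole 1 s1 s2) gapB = footB (- s1) s2.
Proof. by rewrite /footB /pole; apply: coP;
  rewrite co_geod !covE cosh_gapB sinh_gapB; field. Qed.

Lemma geod_gapB' : geod (pole 1 s1 s2) (footB s1 s2) gapB = pole (-1) (- s1) s2.
Proof. by rewrite /footB /pole; apply: coP;
  rewrite co_geod !covE cosh_gapB sinh_gapB; field. Qed.

Lemma geod_touchA : geod (footA s1 s2) (dirA s1 s2) touch = contact s1 s2 (s1 * s2).
Proof. by rewrite /footA /dirA /contact; apply: coP;
  rewrite co_geod !covE cosh_touch sinh_touch; field. Qed.

Lemma geod_touchB : geod (footB s1 s2) (dirB s1 s2) touch = contact s1 s2 (s1 * s2).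
Proof. by rewrite /footB /dirB /contact; apply: coP;
  rewrite co_geod !covE cosh_touch sinh_touch; field. Qed.

Lemma geod_touch2A : geod (footA s1 s2) (dirA s1 s2) (2 * touch) = footB s1 s2.
Proof. by rewrite /footA /dirA /footB; apply: coP;
  rewrite co_geod !covE cosh_touch2 sinh_touch2; field. Qed.

Lemma geod_touch2B : geod (footB s1 s2) (dirB s1 s2) (2 * touch) = footA s1 s2.
Proof. by rewrite /footB /dirB /footA; apply: coP;
  rewrite co_geod !covE cosh_touch2 sinh_touch2; field. Qed.

Lemma mink_dirA_pole : mink (dirA s1 s2) (pole 1 s1 s2) = 0.
Proof. by rewrite /dirA /pole; mink_num. Qed.

Lemma mink_dirB_pole : mink (dirB s1 s2) (pole (-1) s1 s2) = 0.
Proof. by rewrite /dirB /pole; mink_num. Qed.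

Lemma mink_footA_pole : mink (footA s1 s2) (pole 1 s1 s2) = 0.
Proof. by rewrite /footA /pole; mink_num. Qed.

Lemma mink_footB_pole : mink (footB s1 s2) (pole (-1) s1 s2) = 0.
Proof. by rewrite /footB /pole; mink_num. Qed.

Lemma contact_frameA : contact_frame (footA s1 s2) (pole (-1) s1 s2)
  (contact s1 s2 (s1 * s2)) (wall s1 s2 (s1 * s2)) (dirA s1 s2) 0.
Proof.
split; rewrite ?geod0; first exact: line_frameA'.
- by rewrite mink_wall /footA !covE; signs; field.
- by rewrite mink_wall /pole !covE; signs; field.
- by rewrite mink_wall /dirA !covE; signs; field.
- by split; [rewrite /footA /dirA; mink_num|rewrite /pole /dirA; mink_num].
Qed.

Lemma contact_frameB : contact_frame (footB s1 s2) (pole 1 s1 s2)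
  (contact s1 s2 (s1 * s2)) (wall s1 s2 (s1 * s2)) (dirB s1 s2) 0.
Proof.
split; rewrite ?geod0; first exact: line_frameB'.
- by rewrite mink_wall /footB !covE; signs; field.
- by rewrite mink_wall /pole !covE; signs; field.
- by rewrite mink_wall /dirB !covE; signs; field.
- by split; [rewrite /footB /dirB; mink_num|rewrite /pole /dirB; mink_num].
Qed.

Lemma det4_scale_gt0 : 0 < sc 0 * sc 1 * sc 2 * sc 3 :> R.
Proof. by rewrite !mulr_gt0 ?sc_gt0. Qed.

Lemma det4A : 0 < det4 (footA s1 s2) (dirA s1 (- s2)) (dirA s1 s2) (pole (-1) s1 s2).
Proof.
rewrite det4_co; apply: mulr_gt0; first exact: det4_scale_gt0.
by rewrite /footA /dirA /pole !covE /det3; signs; lra.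
Qed.

Lemma det4B : 0 < det4 (footB s1 s2) (dirB (- s1) s2) (dirB s1 s2) (pole 1 s1 s2).
Proof.
rewrite det4_co; apply: mulr_gt0; first exact: det4_scale_gt0.
by rewrite /footB /dirB /pole !covE /det3; signs; lra.
Qed.

End Faces.

Definition lineA s1 s2 := line_of (geod (footA s1 s2) (pole (-1) s1 s2)).
Definition lineB s1 s2 := line_of (geod (footB s1 s2) (pole 1 s1 s2)).

Lemma contact_frameA' s1 s2 : sign_of s1 -> sign_of s2 ->
  contact_frame (footA s1 s2) (pole (-1) s1 s2) (contact s1 (- s2) (s1 * - s2))
    (wall s1 (- s2) (s1 * - s2)) (dirA s1 (- s2)) gapA.
Proof.
move=> h1 h2; split; rewrite ?geod_gapA //; first exact: line_frameA' (sign_opp h2).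
- by rewrite mink_wall /footA !covE;
    case: h1 => ?; case: h2 => ?; subst; field.
- by rewrite mink_wall /pole !covE;
    case: h1 => ?; case: h2 => ?; subst; field.
- by rewrite mink_wall /dirA !covE;
    case: h1 => ?; case: h2 => ?; subst; field.
- by split; rewrite mink_co /footA /pole /dirA !covE;
    case: h1 => ?; case: h2 => ?; subst; field.
Qed.

Lemma contact_frameB' s1 s2 : sign_of s1 -> sign_of s2 ->
  contact_frame (footB s1 s2) (pole 1 s1 s2) (contact (- s1) s2 (- s1 * s2))
    (wall (- s1) s2 (- s1 * s2)) (dirB (- s1) s2) gapB.
Proof.
move=> h1 h2; split; rewrite ?geod_gapB //; first exact: line_frameB' (sign_opp h1) h2.
- by rewrite mink_wall /footB !covE;
    case: h1 => ?; case: h2 => ?; subst; field.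
- by rewrite mink_wall /pole !covE;
    case: h1 => ?; case: h2 => ?; subst; field.
- by rewrite mink_wall /dirB !covE;
    case: h1 => ?; case: h2 => ?; subst; field.
- by split; rewrite mink_co /footB /pole /dirB !covE;
    case: h1 => ?; case: h2 => ?; subst; field.
Qed.

Lemma billiard_domainA s1 s2 : sign_of s1 -> sign_of s2 ->
  billiard_domain surf (lineA s1 s2).
Proof.
move=> h1 h2; exact: (billiard_domain_geod (line_frameA h1 h2)
  (contact_plane_wall h1 h2) (contact_frameA h1 h2) touch_gt0 (geod_touchA _ _)).
Qed.

Lemma billiard_domainB s1 s2 : sign_of s1 -> sign_of s2 ->
  billiard_domain surf (lineB s1 s2).
Proof.
move=> h1 h2; exact: (billiard_domain_geod (line_frameB h1 h2)
  (contact_plane_wall h1 h2) (contact_frameB h1 h2) touch_gt0 (geod_touchB _ _)).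
Qed.

Lemma outer_billiardA s1 s2 : sign_of s1 -> sign_of s2 ->
  outer_billiard surf (lineA s1 s2) (lineB s1 (- s2)).
Proof.
move=> h1 h2; have h2' := sign_opp h2.
exact: (outer_billiard_geod (line_frameA h1 h2) (ltW touch_gt0)
  (geod_gapA _ _) (geod_gapA' _ _) (contact_plane_wall h1 h2')
  (contact_frameA' h1 h2) (geod_touchA _ _) (contact_plane_wall h1 h2)
  (contact_frameA h1 h2) (geod_touchA _ _) (det4A h1 h2)
  (geod_touch2A _ _) (line_frameB h1 h2') (mink_footA_pole h1 h2')
  (mink_dirA_pole h1 h2') (billiard_domainA h1 h2) (billiard_domainB h1 h2')).
Qed.

Lemma outer_billiardB s1 s2 : sign_of s1 -> sign_of s2 ->
  outer_billiard surf (lineB s1 s2) (lineA (- s1) s2).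
Proof.
move=> h1 h2; have h1' := sign_opp h1.
exact: (outer_billiard_geod (line_frameB h1 h2) (ltW touch_gt0)
  (geod_gapB _ _) (geod_gapB' _ _) (contact_plane_wall h1' h2)
  (contact_frameB' h1 h2) (geod_touchB _ _) (contact_plane_wall h1 h2)
  (contact_frameB h1 h2) (geod_touchB _ _) (det4B h1 h2)
  (geod_touch2B _ _) (line_frameA h1' h2) (mink_footB_pole h1' h2)
  (mink_dirB_pole h1' h2) (billiard_domainB h1 h2) (billiard_domainA h1' h2)).
Qed.

Lemma signed_gapA s1 s2 : sign_of s1 -> sign_of s2 ->
  signed_gap surf (lineA s1 s2) gapA.
Proof.
move=> h1 h2; have h2' := sign_opp h2; apply: signed_gap_geod (line_frameA h1 h2) _.
exact: (billiard_data_geod (line_frameA h1 h2) (ltW touch_gt0)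
  (geod_gapA _ _) (contact_plane_wall h1 h2')
  (contact_frameA' h1 h2) (geod_touchA _ _) (contact_plane_wall h1 h2)
  (contact_frameA h1 h2) (geod_touchA _ _) (det4A h1 h2)).
Qed.

Lemma signed_gapB s1 s2 : sign_of s1 -> sign_of s2 ->
  signed_gap surf (lineB s1 s2) gapB.
Proof.
move=> h1 h2; have h1' := sign_opp h1; apply: signed_gap_geod (line_frameB h1 h2) _.
exact: (billiard_data_geod (line_frameB h1 h2) (ltW touch_gt0)
  (geod_gapB _ _) (contact_plane_wall h1' h2)
  (contact_frameB' h1 h2) (geod_touchB _ _) (contact_plane_wall h1 h2)
  (contact_frameB h1 h2) (geod_touchB _ _) (det4B h1 h2)).
Qed.

Lemma line_of_geod0 (q e : 'rV[R]_4) (a : R -> 'rV[R]_4) :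
  line_of (geod q e) = line_of a -> exists t, q = a t.
Proof.
move=> E; have : line_of a (geod q e).
  by rewrite -E; exists 0 => t; rewrite addr0.
by move=> [t h]; exists (0 + t); rewrite -h geod0.
Qed.

(** The quotient of [co 1] by [co 0] is constantly [28/13 * s1] along [lineA s1 s2]. *)
Lemma lineA_inj s1 s2 s1' s2' : lineA s1 s2 = lineA s1' s2' -> s1 = s1'.
Proof.
move=> /line_of_geod0 [t E].
have e0 := congr1 (co 0) E; have e1 := congr1 (co 1) E.
move: e0 e1; rewrite !co_geod /footA /pole !covE => e0 e1.
by move: (cosh t) (sinh t) e0 e1 => c s e0 e1; nra.
Qed.

Lemma lineB_inj s1 s2 s1' s2' : lineB s1 s2 = lineB s1' s2' -> s2 = s2'.
Proof.
move=> /line_of_geod0 [t E].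
have e0 := congr1 (co 0) E; have e1 := congr1 (co 2) E.
move: e0 e1; rewrite !co_geod /footB /pole !covE => e0 e1.
by move: (cosh t) (sinh t) e0 e1 => c s e0 e1; nra.
Qed.

(** Along [lineB s1' s2'] the quotient of [co 2] by [co 0] is constantly [24/13 * s2'], whereas at
    [footA s1 s2] it is [s2 / 78]. *)
Lemma lineAB_neq s1 s2 s1' s2' : sign_of s2 -> sign_of s2' ->
  lineA s1 s2 <> lineB s1' s2'.
Proof.
move=> h2 h2' /line_of_geod0 [t E].
have e0 := congr1 (co 0) E; have e1 := congr1 (co 2) E.
move: e0 e1; rewrite !co_geod /footA /footB /pole !covE.
by move: (cosh t) (sinh t) => c s; case: h2 => ->; case: h2' => ->; lra.
Qed.

(** Changing [s2] in [lineA] or [s1] in [lineB] reverses the line, so the signs describe eight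
    oriented sides. Crossing a face from an [A] line changes [s2], from a [B] line [s1]; this makes
    two cycles of length four, of which this is one. *)
Definition orbit : 'I_4 -> set (R -> 'rV[R]_4) := fun k =>
  nth set0 [:: lineB (-1) 1; lineA 1 1; lineB 1 (-1); lineA (-1) (-1)] k.

Lemma orbit_inj : injective orbit.
Proof.
have p1 : sign_of 1 by left.
have m1 : sign_of (-1) by right.
have ne : (1 : R) <> -1 by lra.
move=> [[|[|[|[|//]]]] hi] [[|[|[|[|//]]]] hj]; rewrite /orbit /= => E;
  apply/val_inj => /=; try reflexivity; exfalso.
- exact: (lineAB_neq p1 p1 (esym E)).
- exact: (ne (lineB_inj E)).
- exact: (lineAB_neq m1 p1 (esym E)).
- exact: (lineAB_neq p1 p1 E).
- exact: (lineAB_neq p1 m1 E).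
- exact: (ne (lineA_inj E)).
- exact: (ne (esym (lineB_inj E))).
- exact: (lineAB_neq p1 m1 (esym E)).
- exact: (lineAB_neq m1 m1 (esym E)).
- exact: (lineAB_neq m1 p1 E).
- exact: (ne (esym (lineA_inj E))).
- exact: (lineAB_neq m1 m1 E).
Qed.

Lemma periodic_orbit_surf : periodic_orbit surf orbit.
Proof.
have p1 : sign_of 1 by left.
have m1 : sign_of (-1) by right.
have b0 := outer_billiardB m1 p1; have b1 := outer_billiardA p1 p1.
have b2 := outer_billiardB p1 m1; have b3 := outer_billiardA m1 m1.
rewrite !opprK in b0 b3.
by split; [exact: orbit_inj|move=> [[|[|[|[|//]]]] hi]; rewrite /orbit /=].
Qed.

Lemma is_holonomy_surf : is_holonomy surf orbit (2 * (gapA + gapB)).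
Proof.
have p1 : sign_of 1 by left.
have m1 : sign_of (-1) by right.
exists (fun k : 'I_4 => nth 0 [:: gapB; gapA; gapB; gapA] k); split.
  move=> [[|[|[|[|//]]]] hi]; rewrite /orbit /=;
    by [exact: signed_gapA|exact: signed_gapB].
by rewrite !big_ord_recl big_ord0 /=; ring.
Qed.

Lemma holonomy_neq0 : 2 * (gapA + gapB) <> 0.
Proof.
have : ln (15 / 13) < ln (13 / 11) :> R by rewrite ltr_ln ?posrE; lra.
by rewrite /gapA /gapB => h; lra.
Qed.

End Orbit.

Theorem proposition1p9 (R : realType) :
  exists (S : set 'rV[R]_4) (L : set (R -> 'rV[R]_4)),
    [/\ closed_surface S,
        quadratically_convex S,
        billiard_domain S L &
        exists (n : nat) (l : 'I_n.+1 -> set (R -> 'rV[R]_4)) (h : R),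
          [/\ periodic_orbit S l, l ord0 = L, is_holonomy S l h & h <> 0]].
Proof.
exists surf, (lineB (-1) 1); split.
- exact: closed_surface_surf.
- exact: quadratically_convex_surf.
- by apply: billiard_domainB; [right|left].
(* The period is [3.+1], the index type being ['I_n.+1]. *)
- exists 3%N, orbit, (2 * (gapA + gapB)); split => //.
  + exact: periodic_orbit_surf.
  + exact: is_holonomy_surf.
  + exact: holonomy_neq0.
Qed.
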